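(* There is a universal constant $C>0$ such that for every weighted finite graph $G$ with $N$ vertices and all $1\leq k\leq l\leq N$, \[ 1-\overline{h}(k)\leq Clk^6\,\frac{2-\lambda_{N-k+1}}{\sqrt{2-\lambda_{N-l+1}}}. \]
   Context: $G=(V,E,w)$ is a finite undirected graph without self-loops, $N=|V|$, positive symmetric edge weights $w_{uv}$ ($w_{uv}=0$ for non-edges), degrees $d_u=\sum_vw_{uv}$ (implicitly positive). $|E(A,B)|:=\sum_{u\in A,v\in B}w_{uv}$, $\mathrm{vol}(A)=\sum_{u\in A}d_u$. The normalized Laplacian $\Delta f(u)=\frac{1}{d_u}\sum_vw_{uv}(f(u)-f(v))$ has eigenvalues (with multiplicity) $0=\lambda_1\leq\cdots\leq\lambda_N\leq2$. For disjoint $V_1,V_2$ with $V_1\cup V_2\neq\emptyset$, $\overline{\phi}(V_1,V_2)=2|E(V_1,V_2)|/\mathrm{vol}(V_1\cup V_2)$; $\overline{h}(k):=\max\min_{1\leq i\leq k}\overline{\phi}(V_{2i-1},V_{2i})$ over all collections of $k$ pairs $(V_1,V_2),\ldots,(V_{2k-1},V_{2k})$ of pairwise disjoint subsets of $V$ with $V_{2i-1}\cup V_{2i}\neq\emptyset$ for each $i$. *)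

(* Defs.v *)
From HB Require Import structures.
From mathcomp Require Import all_boot all_order all_algebra.
From mathcomp Require Import Rstruct.
From Stdlib Require Import Rdefinitions.
Set Implicit Arguments. Unset Strict Implicit. Unset Printing Implicit Defensive.
Import Order.TTheory GRing.Theory Num.Theory.
Local Open Scope ring_scope.

(* A weighted graph on the vertex set 'I_N is given by a weight function
   w : 'I_N -> 'I_N -> R; w u v > 0 for edges, w u v = 0 for non-edges. *)
Definition weighted_graph (N : nat) (w : 'I_N -> 'I_N -> R) : Prop :=
  (forall u v, w u v = w v u) /\
  (forall u, w u u = 0) /\
  (forall u v, 0 <= w u v).

Definition deg (N : nat) (w : 'I_N -> 'I_N -> R) (u : 'I_N) : R :=
  \sum_(v < N) w u v.

Definition cut (N : nat) (w : 'I_N -> 'I_N -> R) (A B : {set 'I_N}) : R :=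
  \sum_(u in A) \sum_(v in B) w u v.

Definition vol (N : nat) (w : 'I_N -> 'I_N -> R) (A : {set 'I_N}) : R :=
  \sum_(u in A) deg w u.

Definition phibar (N : nat) (w : 'I_N -> 'I_N -> R) (V1 V2 : {set 'I_N}) : R :=
  2 * cut w V1 V2 / vol w (V1 :|: V2).

Definition nlap (N : nat) (w : 'I_N -> 'I_N -> R) : 'M[R]_N :=
  \matrix_(u, v) ((u == v)%:R - w u v / deg w u).

(* s is the list of eigenvalues of Delta, with multiplicity, in increasing order:
   s`_(i-1) = lambda_i. *)
Definition is_spectrum (N : nat) (w : 'I_N -> 'I_N -> R) (s : seq R) : Prop :=
  sorted <=%R s /\ char_poly (nlap w) = \prod_(x <- s) ('X - x%:P).

(* a collection of k pairs (V_{2i-1}, V_{2i}) = V i, all 2k subsets pairwise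
   disjoint, each pair with nonempty union *)
Definition valid_pairs (N k : nat) (V : {ffun 'I_k -> {set 'I_N} * {set 'I_N}}) : bool :=
  [forall i, [disjoint (V i).1 & (V i).2] && ((V i).1 :|: (V i).2 != set0)] &&
  [forall i, forall j, (i != j) ==>
     [&& [disjoint (V i).1 & (V j).1], [disjoint (V i).1 & (V j).2],
         [disjoint (V i).2 & (V j).1] & [disjoint (V i).2 & (V j).2]]].

(* min over i of phibar; the default 1 is harmless since phibar <= 1 and k >= 1 *)
Definition min_phibar (N k : nat) (w : 'I_N -> 'I_N -> R)
    (V : {ffun 'I_k -> {set 'I_N} * {set 'I_N}}) : R :=
  \big[Num.min/1]_(i < k) phibar w (V i).1 (V i).2.

(* h-bar(k): maximum over valid collections; the default 0 is harmless since
   all values are >= 0 and valid collections exist for 1 <= k <= N *)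
Definition hbar (N : nat) (w : 'I_N -> 'I_N -> R) (k : nat) : R :=
  \big[Num.max/0]_(V : {ffun 'I_k -> {set 'I_N} * {set 'I_N}} | valid_pairs V)
     min_phibar w V.

(* Main.v *)
(** Let L_k = 2 - lambda_{N-k+1} and call the quadratic form of 2 - Delta the
    dual energy. The k top eigenfunctions embed V into R^k with small dual
    energy. After radial projection to the sphere, each coordinate axis is cut
    at a well chosen shift of a lattice; using the same shift for x_j and -x_j
    makes the cells antipodally symmetric, which suits the signs in
    (f(u) + f(v))^2. By orthonormality a small cell carries a bounded part of
    the mass, so cells can be merged into k groups, and cutting the embedding
    off near the cuts gives k disjointly supported functions with dual Rayleigh
    quotient O(k^5 L_k).

    For a single f, unless |f| is close to a set T of O(l) values, tents over
    consecutive bands of |f| give l disjointly supported functions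
    contradicting Courant-Fischer for L_l. Sweeping sign(f) mu(|f|), where
    mu' is comparable to the distance to T, then yields a pair of sets with
    1 - phibar <= O(l) R(f) / sqrt(L_l), as mu(x) >= x^2 / O(l). *)

(* The exponent of k comes from averaging over the shift. The cut-off has slope of order k^3 in the
   coordinates of the embedding, so for one fixed lattice the bound on its energy would carry k^6.
   Summed over all m shifts, however, the squared change of the cut-off between two points is at
   most 7, not m, times their squared distance in lattice units. As m has order k^2, the average
   cost is k^4, and the k eigenfunctions together give k^5. The tight resource is mass: k groups of
   mass at least 1/2 are taken from a total of k, while one piece may weigh as much as 1 + 1/(4k).
   Hence the cut-off may lose only a constant; this fixes the width of the cells and the number of
   shifts. For a single function, the root of L_l is the weight that balances the two terms of an
   arithmetic-geometric mean inequality: the energy E, and the squared distance of |f| to T, which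
   has total mass O(E / L_l). If L_l = 0, the quotient in the theorem is 0 by the convention x / 0 =
   0. Then k <= l forces L_k = 0, and the functions to be swept have dual energy exactly 0. *)
Require Import Defs.
From HB Require Import structures.
From mathcomp Require Import all_boot all_order all_algebra.
From mathcomp Require Import ring lra zify.
From mathcomp Require Import Rstruct.
From Stdlib Require Import Rdefinitions.
Set Implicit Arguments. Unset Strict Implicit. Unset Printing Implicit Defensive.
Import Order.TTheory GRing.Theory Num.Theory.
Local Open Scope ring_scope.

(** * Orthogonal diagonalization *)

(* Householder reflection *)
Lemma orthogonal_first_row (R : rcfType) n (v : 'rV[R]_(1 + n)) :
  v *m v^T = 1%:M ->
  exists2 H : 'M[R]_(1 + n), H *m H^T = 1%:M & row 0 H = v.
Proof.
move=> v1; pose e := row 0 (1%:M : 'M[R]_(1 + n)).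
have eM p (B : 'M[R]_(1 + n, p)) : e *m B = row 0 B by rewrite -row_mul mul1mx.
have [->|ve] := eqVneq v e; first by exists 1%:M; rewrite ?trmx1 ?mulmx1.
pose u := v - e.
have e1 : e *m e^T = 1%:M.
  by rewrite eM; apply/matrixP=> i j; rewrite !ord1 !mxE.
have ev : v *m e^T = e *m v^T.
  by rewrite -[LHS]trmxK trmx_mul trmxK; apply/matrixP => i j; rewrite mxE !ord1.
pose q := (u *m u^T) 0 0.
have uq : u *m u^T = q%:M by rewrite [LHS]mx11_scalar.
have q0 : q != 0.
  apply: contra_neq ve => q0; apply/eqP; rewrite -subr_eq0; apply/eqP/rowP => j.
  rewrite [RHS]mxE; move: q0; rewrite /q mxE => /eqP; rewrite psumr_eq0; last first.
    by move=> i _; rewrite [u^T _ _]mxE -expr2 sqr_ge0.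
  by move=> /allP /(_ j); rewrite mem_index_enum => /(_ isT) /=; rewrite [u^T _ _]mxE mulf_eq0 orbb => /eqP.
have eu : e *m u^T = (- (q / 2))%:M.
  have : u *m u^T = - (e *m u^T) - (e *m u^T).
    rewrite {1}/u mulmxBl; congr (_ - _).
    by rewrite /u linearB /= !mulmxBr v1 e1 ev opprB.
  rewrite uq [e *m u^T]mx11_scalar; set y := (e *m u^T) 0 0 => h; congr (_%:M).
  have /(congr1 (fun M : 'M_1 => M 0 0)) := h; rewrite !mxE /= !mulr1n => ->.
  by field.
exists (1%:M - (2 / q) *: (u^T *m u)).
  have -> : (1%:M - (2 / q) *: (u^T *m u))^T = 1%:M - (2 / q) *: (u^T *m u).
    by rewrite [LHS]linearB /= trmx1 [(_ *: _)^T]linearZ /= trmx_mul trmxK.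
  have uu : u^T *m u *m (u^T *m u) = q *: (u^T *m u).
    by rewrite mulmxA -[u^T *m u *m u^T]mulmxA uq mul_mx_scalar scalemxAl.
  rewrite mulmxBr mulmx1 mulmxBl mul1mx -scalemxAl -scalemxAr uu !scalerA.
  rewrite (_ : 2 / q * (2 / q) * q = 2 / q + 2 / q); last by field.
  by rewrite scalerDl opprB addrK subrK.
rewrite -eM mulmxBr mulmx1 -scalemxAr mulmxA eu mul_scalar_mx scalerA.
rewrite (_ : 2 / q * _ = -1); last by field.
by rewrite scaleN1r opprK /u addrC subrK.
Qed.

Lemma char_poly_similar (R : comNzRingType) n (P Q A : 'M[R]_n) :
  P *m Q = 1%:M -> char_poly (P *m A *m Q) = char_poly A.
Proof.
move=> PQ; rewrite /char_poly.
have -> : char_poly_mx (P *m A *m Q) =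
    map_mx polyC P *m char_poly_mx A *m map_mx polyC Q.
  rewrite /char_poly_mx mulmxBr mulmxBl -!map_mxM; congr (_ - _).
  by rewrite scalar_mxC -mulmxA -map_mxM PQ map_mx1 mulmx1.
rewrite !det_mulmx mulrC mulrA -det_mulmx -map_mxM /= (mulmx1C PQ) map_mx1 det1.
by rewrite mul1r.
Qed.

(** The split characteristic polynomial supplies a real eigenvalue at every deflation step, and
    deflating in the order of [s] attaches the i-th row of [P] to the i-th entry of [s]. *)
Lemma symmetric_spectral (R : rcfType) n (A : 'M[R]_n) (s : seq R) :
  A^T = A -> char_poly A = \prod_(x <- s) ('X - x%:P) ->
  exists2 P : 'M[R]_n, P *m P^T = 1%:M & P *m A *m P^T = diag_mx (\row_i s`_i).
Proof.
elim: n => [|n IHn] in A s *.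
  by move=> _ _; exists 1%:M; rewrite [LHS]flatmx0 [RHS]flatmx0.
move=> symA chA.
have ss : size s = n.+1.
  by have := size_char_poly A; rewrite chA size_prod_XsubC => -[].
case: s ss chA => [//|x s] [ss] chA.
have /eigenvalueP[v0 v0A v0n] : eigenvalue A x.
  by rewrite eigenvalue_root_char chA root_prod_XsubC mem_head.
pose q := (v0 *m v0^T) 0 0.
have q_gt0 : 0 < q.
  rewrite /q mxE lt_def psumr_eq0; last by move=> i _; rewrite mxE -expr2 sqr_ge0.
  rewrite sumr_ge0 ?andbT; last by move=> i _; rewrite mxE -expr2 sqr_ge0.
  apply: contraNN v0n => /allP v00; apply/eqP/rowP => j; rewrite [RHS]mxE.
  have := v00 j; rewrite mem_index_enum => /(_ isT) /=.
  by rewrite [_^T _ _]mxE mulf_eq0 orbb => /eqP.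
pose v := (Num.sqrt q)^-1 *: v0.
have sq0 : Num.sqrt q != 0 by rewrite gt_eqF // sqrtr_gt0.
have vv : v *m v^T = 1%:M.
  rewrite /v linearZ /= -scalemxAl -scalemxAr scalerA [v0 *m _]mx11_scalar -/q.
  rewrite scale_scalar_mx -{3}[q]sqr_sqrtr ?ltW //; congr (_%:M).
  by field.
have vA : v *m A = x *: v by rewrite /v -scalemxAl v0A !scalerA mulrC.
have [H HH rH] := @orthogonal_first_row R n v vv.
have [B defB] : exists B : 'M_(1 + n), B = H *m (A : 'M_(1 + n)) *m H^T by eexists.
have symB : B^T = B by rewrite defB !trmx_mul trmxK symA mulmxA.
have rB : row 0 B = x *: row 0 1%:M.
  by rewrite defB !row_mul rH vA -scalemxAl -rH -row_mul HH.
have eB : B = block_mx x%:M 0 0 (drsubmx B).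
  rewrite -[LHS]submxK; congr block_mx.
  - apply/matrixP => i j; rewrite !ord1 !mxE.
    have /rowP /(_ 0) := rB; rewrite !mxE /= mulr1n mulr1 => <-.
    by congr (B _ _); apply: val_inj.
  - apply/matrixP => i j; rewrite !ord1 !mxE.
    have /rowP /(_ (rshift 1 j)) := rB; rewrite !mxE /= mulr0 => <-.
    by congr (B _ _); apply: val_inj.
  - apply/matrixP => i j; rewrite !ord1 !mxE -symB mxE.
    have /rowP /(_ (rshift 1 i)) := rB; rewrite !mxE /= mulr0 => <-.
    by congr (B _ _); apply: val_inj.
set A' := drsubmx B in eB.
have symA' : A'^T = A' by rewrite /A' trmx_drsub symB.
have chA' : char_poly A' = \prod_(x <- s) ('X - x%:P).
  have := @char_poly_similar _ _ H H^T A HH; rewrite -defB eB /char_poly.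
  rewrite char_block_diag_mx det_ublock -[RHS]/(char_poly A) chA big_cons.
  rewrite {1}/char_poly_mx det_mx11 !mxE /= mulr1n.
  by move/(mulfI (negbT (polyXsubC_eq0 x))).
have [P' PP' dP'] := IHn _ _ symA' chA'.
pose P : 'M_(1 + n) := block_mx 1%:M 0 0 P' *m H.
have tP : P^T = H^T *m block_mx 1%:M 0 0 P'^T.
  by rewrite /P trmx_mul tr_block_mx !trmx0 trmx1.
have HHm (Q Z : 'M_(1 + n)) : Q *m H *m (H^T *m Z) = Q *m Z.
  by rewrite mulmxA -(mulmxA Q) HH mulmx1.
exists P; rewrite tP /P.
  rewrite HHm mulmx_block.
  by rewrite !(mulmx0, mul0mx, addr0, add0r, mulmx1) PP' -scalar_mx_block.
have -> : block_mx 1%:M 0 0 P' *m H *m A *m (H^T *m block_mx 1%:M 0 0 P'^T)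
    = block_mx 1%:M 0 0 P' *m B *m block_mx 1%:M 0 0 P'^T.
  by rewrite defB !mulmxA.
rewrite eB !mulmx_block !(mulmx0, mul0mx, addr0, add0r, mulmx1, mul1mx) dP'.
apply/matrixP => i j; rewrite !mxE.
by case: splitP => i' ei; rewrite !mxE; case: splitP => j' ej;
  rewrite !mxE -!val_eqE /= ei ej ?ord1.
Qed.

(** * Spectrum of the Laplacian *)

Definition mass (N : nat) (w : 'I_N -> 'I_N -> R) (f : 'I_N -> R) :=
  \sum_u deg w u * f u ^+ 2.

(* Twice the quadratic form of [2 - Delta]: each edge is counted in both directions. *)
Definition dual_energy (N : nat) (w : 'I_N -> 'I_N -> R) (f : 'I_N -> R) :=
  \sum_u \sum_v w u v * (f u + f v) ^+ 2.

Section Spectrum.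
Variables (N : nat) (w : 'I_N -> 'I_N -> R).
Hypothesis wG : weighted_graph w.
Hypothesis d_gt0 : forall u, 0 < deg w u.

Let wC : forall u v, w u v = w v u. Proof. by case: wG. Qed.
Let w_ge0 : forall u v, 0 <= w u v. Proof. by case: wG => _ []. Qed.

Lemma mass_ge0 f : 0 <= mass w f.
Proof. by apply: sumr_ge0 => u _; rewrite mulr_ge0 ?sqr_ge0 // ltW. Qed.

Lemma mass_eq0 f : mass w f = 0 -> forall u, f u = 0.
Proof.
move=> /eqP; rewrite psumr_eq0 => [/allP h u|u _]; last by rewrite mulr_ge0 ?sqr_ge0 // ltW.
have := h u; rewrite mem_index_enum => /(_ isT) /=.
by rewrite mulf_eq0 gt_eqF //= expf_eq0 /= => /eqP.
Qed.

Lemma dual_energy_ge0 f : 0 <= dual_energy w f.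
Proof. by do 2![apply: sumr_ge0 => ? _]; rewrite mulr_ge0 ?sqr_ge0. Qed.

Lemma sum_deg (F : 'I_N -> R) :
  \sum_u \sum_v w u v * F u = \sum_u deg w u * F u.
Proof. by apply: eq_bigr => u _; rewrite -mulr_suml. Qed.

Lemma sum_deg_sym (F : 'I_N -> R) :
  \sum_u \sum_v w u v * F v = \sum_u deg w u * F u.
Proof. by rewrite exchange_big -sum_deg; do 2![apply: eq_bigr => ? _]; rewrite wC. Qed.

Lemma dual_energy_expand f : dual_energy w f =
  2 * mass w f + 2 * \sum_u \sum_v w u v * (f u * f v).
Proof.
have -> : 2 * mass w f = mass w f + mass w f by ring.
rewrite {1}/mass -sum_deg /mass -sum_deg_sym mulr_sumr -!big_split /=.
apply: eq_bigr => u _; rewrite mulr_sumr -!big_split /=.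
by apply: eq_bigr => v _; ring.
Qed.

Lemma dual_energy_le f : dual_energy w f <= 4 * mass w f.
Proof.
have -> : 4 * mass w f = 2 * mass w f + 2 * mass w f by ring.
rewrite {1}/mass -sum_deg /mass -sum_deg_sym !mulr_sumr -!big_split /=.
apply: ler_sum => u _; rewrite !mulr_sumr -!big_split /=.
apply: ler_sum => v _; have := w_ge0 u v; have := sqr_ge0 (f u - f v).
by move: (f u) (f v) (w u v) => x y z; nra.
Qed.

(** [nlap w] is not symmetric, but conjugation by the square root of the degree matrix makes it so
    without changing the characteristic polynomial. Rows of the orthogonal matrix, divided by the
    roots of the degrees, are then orthonormal for the degree measure. The 2 in the energy comes
    from counting edges in both directions. *)
Lemma eigenbasis (s : seq R) : is_spectrum w s ->
  exists P : 'I_N -> 'I_N -> R,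
  [/\ forall i j, \sum_u deg w u * (P i u * P j u) = (i == j)%:R,
      forall c : 'I_N -> R, mass w (fun u => \sum_i c i * P i u) = \sum_i c i ^+ 2,
      forall c : 'I_N -> R, dual_energy w (fun u => \sum_i c i * P i u) =
                  \sum_(i < N) 2 * (2 - s`_i) * c i ^+ 2 &
      forall (h : 'I_N -> R) u,
        h u = \sum_i (\sum_v deg w v * (h v * P i v)) * P i u].
Proof.
move=> [_ chp]; pose r u := Num.sqrt (deg w u).
have r_gt0 u : 0 < r u by rewrite sqrtr_gt0.
have r0 u : r u != 0 by rewrite gt_eqF.
have rr u : deg w u = r u * r u by rewrite -expr2 sqr_sqrtr // ltW.
pose A : 'M[R]_N := \matrix_(u, v) ((u == v)%:R - w u v / (r u * r v)).
have symA : A^T = A by apply/matrixP => u v; rewrite !mxE eq_sym wC [r v * _]mulrC.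
have chA : char_poly A = \prod_(x <- s) ('X - x%:P).
  rewrite -chp.
  have DD : diag_mx (\row_u r u) *m diag_mx (\row_u (r u)^-1) = 1%:M :> 'M[R]_N.
    rewrite mulmx_diag; apply/matrixP => u v; rewrite !mxE; case: eqP => // _.
    by rewrite divff.
  rewrite -(char_poly_similar (nlap w) DD); congr char_poly.
  apply/matrixP => u v; rewrite mul_diag_mx mul_mx_diag !mxE rr.
  by case: eqP => [<-|_]; rewrite ?mulr0n; field; rewrite ?r0.
have [P PP dP] := symmetric_spectral symA chA.
have PTP := mulmx1C PP.
have mx (x : 'rV[R]_N) : mass w (fun u => x 0 u / r u) = (x *m x^T) 0 0.
  rewrite mxE; apply: eq_bigr => u _; rewrite rr mxE; field; exact: r0.
have ex (x : 'rV[R]_N) : dual_energy w (fun u => x 0 u / r u) =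
    4 * (x *m x^T) 0 0 - 2 * (x *m A *m x^T) 0 0.
  rewrite dual_energy_expand mx.
  suff -> : (x *m A *m x^T) 0 0 = (x *m x^T) 0 0 -
      \sum_u \sum_v w u v * (x 0 u / r u * (x 0 v / r v)) by ring.
  rewrite exchange_big /= !mxE -sumrB; apply: eq_bigr => v _; rewrite !mxE mulr_suml.
  rewrite (eq_bigr (fun u => x 0 u * (u == v)%:R * x 0 v -
     w u v * (x 0 u / r u * (x 0 v / r v)))); last first.
    by move=> u _; rewrite !mxE; field; rewrite !r0.
  rewrite sumrB; congr (_ - _); rewrite (bigD1 v) //= eqxx mulr1 big1 ?addr0 //.
  by move=> u /negbTE ->; rewrite mulr0 mul0r.
have lin (c : 'I_N -> R) u : \sum_i c i * (P i u / r u) = ((\row_i c i) *m P) 0 u / r u.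
  by rewrite mxE mulr_suml; apply: eq_bigr => i _; rewrite !mxE mulrA.
exists (fun i u => P i u / r u); split.
- move=> i j; have /matrixP /(_ i j) := PP; rewrite !mxE => <-.
  by apply: eq_bigr => u _; rewrite rr !mxE; field; exact: r0.
- move=> c; rewrite /mass; under eq_bigr => u _ do rewrite lin.
  rewrite -/(mass w (fun u => ((\row_i c i) *m P) 0 u / r u)) mx trmx_mul.
  rewrite mulmxA -[_ *m P *m P^T]mulmxA PP mulmx1 mxE.
  by apply: eq_bigr => i _; rewrite !mxE -expr2.
- move=> c; rewrite /dual_energy; under eq_bigr => u _ do under eq_bigr => v _ do rewrite !lin.
  rewrite -/(dual_energy w (fun u => ((\row_i c i) *m P) 0 u / r u)) ex trmx_mul.
  rewrite mulmxA -[_ *m P *m P^T]mulmxA PP mulmx1 !mulmxA.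
  have -> : \row_i c i *m P *m A *m P^T = \row_i c i *m (P *m A *m P^T) by rewrite !mulmxA.
  rewrite dP mul_mx_diag !mxE !mulr_sumr -sumrB.
  by apply: eq_bigr => i _; rewrite !mxE; ring.
- move=> h u; rewrite lin.
  have -> : \row_i \sum_v deg w v * (h v * (P i v / r v)) = (\row_v (h v * r v)) *m P^T.
    apply/rowP => i; rewrite !mxE; apply: eq_bigr => v _; rewrite !mxE rr.
    by field; exact: r0.
  by rewrite -mulmxA PTP mulmx1 mxE mulfK.
Qed.

End Spectrum.

(** * Courant-Fischer at the top of the spectrum *)

Lemma nontrivial_left_kernel (F : fieldType) n (M : 'M[F]_(n.+1, n)) :
  exists2 c : 'rV[F]_n.+1, c != 0 & c *m M = 0.
Proof.
have : kermx M != 0.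
  by rewrite kermx_eq0 /row_free neq_ltn ltnS rank_leq_col.
by case/rowV0Pn => c /sub_kermxP cM c0; exists c.
Qed.

Section CourantFischer.
Variables (N : nat) (w : 'I_N -> 'I_N -> R) (s : seq R).
Hypothesis wG : weighted_graph w.
Hypothesis d_gt0 : forall u, 0 < deg w u.
Hypothesis spec : is_spectrum w s.

Lemma size_spectrum : size s = N.
Proof.
by case: spec => _ chp; have := size_char_poly (nlap w); rewrite chp size_prod_XsubC => -[].
Qed.

Lemma spectrum_le i j : (i <= j)%nat -> (j < N)%nat -> s`_i <= s`_j.
Proof.
move=> ij jN; case: spec => srt _.
by apply: (sorted_leq_nth le_trans le_refl 0 srt) => //; rewrite inE size_spectrum // (leq_ltn_trans ij).
Qed.

Lemma eigenfunctions : exists P : 'I_N -> 'I_N -> R,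
  (forall i j, \sum_u deg w u * (P i u * P j u) = (i == j)%:R) /\
  (forall i : 'I_N, dual_energy w (P i) = 2 * (2 - s`_i)).
Proof.
have [P [oP _ eP _]] := eigenbasis wG d_gt0 spec; exists P; split=> // i.
have := eP (fun j => (j == i)%:R); rewrite (bigD1 i) //= big1; last first.
  by move=> j /negbTE ->; rewrite expr0n mulr0.
rewrite eqxx expr1n mulr1 addr0 => <-; rewrite /dual_energy.
have E u : \sum_j (j == i)%:R * P j u = P i u.
  by rewrite (bigD1 i) //= eqxx mul1r big1 ?addr0 // => j /negbTE ->; rewrite mul0r.
by apply: eq_bigr => u _; apply: eq_bigr => v _; rewrite !E.
Qed.

Lemma gap_le2 i : (i < N)%nat -> 2 - s`_i <= 2.
Proof.
move=> iN; have [P [oP eP]] := eigenfunctions.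
have := dual_energy_le wG (P (Ordinal iN)); rewrite eP /=.
have -> : mass w (P (Ordinal iN)) = 1.
  transitivity ((Ordinal iN == Ordinal iN)%:R : R); last by rewrite eqxx.
  rewrite -oP.
  by apply: eq_bigr => u _; rewrite expr2.
by lra.
Qed.

Lemma gap_ge0 i : (i < N)%nat -> 0 <= 2 - s`_i.
Proof.
move=> iN; have [P [oP eP]] := eigenfunctions.
by have := dual_energy_ge0 wG (P (Ordinal iN)); rewrite eP /=; lra.
Qed.

Lemma top_eigenfunctions k : (k <= N)%nat ->
  exists f : 'I_k -> 'I_N -> R,
  (forall i j, \sum_u deg w u * (f i u * f j u) = (i == j)%:R) /\
  (forall i, dual_energy w (f i) <= 2 * (2 - s`_(N - k))).
Proof.
move=> kN; have [P [oP eP]] := eigenfunctions.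
have h (i : 'I_k) : (N - k + i < N)%nat by have := ltn_ord i; lia.
exists (fun i => P (Ordinal (h i))); split=> [i j|i].
  by rewrite oP -val_eqE /= eqn_add2l.
rewrite eP /=; have : s`_(N - k) <= s`_(N - k + i) by apply: spectrum_le; rewrite ?leq_addr.
by lra.
Qed.

(** Some nontrivial combination of l functions is orthogonal to the l - 1 top eigenfunctions, so its
    expansion involves only the remaining eigenvalues. Only [c] is claimed to be nonzero;
    disjointness of supports will later turn this into positive total weight. *)
Lemma test_functions l (h : 'I_l -> 'I_N -> R) : (0 < l <= N)%nat ->
  exists2 c : 'I_l -> R, exists i, c i != 0 &
  2 * (2 - s`_(N - l)) * mass w (fun u => \sum_i c i * h i u) <=
    dual_energy w (fun u => \sum_i c i * h i u).
Proof.
case: l h => // l h /= lN; have [P [oP mP eP cP]] := eigenbasis wG d_gt0 spec.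
(* There are now l + 1 functions, and [jP] enumerates the l positions strictly above N - (l + 1). *)
have jP (j : 'I_l) : (N - l + j < N)%nat by have := ltn_ord j; lia.
pose M : 'M[R]_(l.+1, l) :=
  \matrix_(i, j) \sum_v deg w v * (h i v * P (Ordinal (jP j)) v).
have [c c0 cM] := nontrivial_left_kernel M.
exists (fun i => c 0 i).
  by have /rV0Pn [i ci] := c0; exists i.
set H := fun u => _.
pose b j := \sum_v deg w v * (H v * P j v).
have b0 (j : 'I_N) : (N - l.+1 < j)%nat -> b j = 0.
  move=> jl; have jl' : (j - (N - l) < l)%nat by have := ltn_ord j; lia.
  have /rowP /(_ (Ordinal jl')) := cM; rewrite !mxE => <-.
  rewrite /b (eq_bigr (fun v => \sum_i deg w v * (c 0 i * h i v * P j v))); last first.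
    by move=> v _; rewrite /H [X in _ * X]mulr_suml mulr_sumr.
  rewrite exchange_big; apply: eq_bigr => i _; rewrite !mxE mulr_sumr.
  have -> : Ordinal (jP (Ordinal jl')) = j by apply: val_inj => /=; lia.
  by apply: eq_bigr => v _; ring.
have HE u : H u = \sum_i b i * P i u by rewrite [LHS]cP.
have -> : mass w H = \sum_i b i ^+ 2.
  by rewrite -mP; apply: eq_bigr => u _; rewrite HE.
have -> : dual_energy w H = \sum_(i < N) 2 * (2 - s`_i) * b i ^+ 2.
  by rewrite -eP; apply: eq_bigr => u _; apply: eq_bigr => v _; rewrite !HE.
rewrite mulr_sumr; apply: ler_sum => i _.
have [il|/b0 ->] := leqP i (N - l.+1); last by rewrite expr0n !mulr0.
apply: ler_wpM2r; first exact: sqr_ge0.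
have : s`_i <= s`_(N - l.+1) by apply: spectrum_le => //; lia.
by lra.
Qed.

End CourantFischer.

(** * Thresholds on the half-line *)

Definition tent (R : realFieldType) (a b x : R) : R :=
  Num.max 0 (Num.min (x - a) (b - x)).

(** Odd, because the dual energy compares f u with - f v: composing f with an odd 1-Lipschitz
    function does not increase |f u + f v| on any edge. *)
Definition odd_tent (R : realFieldType) (a b x : R) : R :=
  tent a b x - tent a b (- x).

Fixpoint thr_dist (R : realFieldType) (x b : R) (T : seq R) : R :=
  if T is t :: T' then Num.min `|x - b| (thr_dist x t T') else `|x - b|.

Definition clamp (R : realFieldType) (L c : R) : R := Num.max 0 (Num.min c L).

(* Antiderivative of [c * (L - c) / L], clamped to [0, L]; the integrand is a
   polynomial lower approximation of the distance to the endpoints. *)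
Definition bump (R : realFieldType) (L c : R) : R :=
  clamp L c ^+ 2 / 2 - clamp L c ^+ 3 / (3 * L).

(** The function mu that reshapes |f|: one bump per gap between thresholds, and beyond the last
    threshold the exact integral of x - b. *)
Fixpoint thr_pot (R : realFieldType) (x b : R) (T : seq R) : R :=
  if T is t :: T' then bump (t - b) (x - b) + thr_pot x t T'
  else (Num.max 0 (x - b)) ^+ 2 / 2.

Section OneDim.
Variable R : realFieldType.
Implicit Types (a b x y t c L D : R) (T : seq R).

Ltac minmax :=
  repeat (match goal with |- context [Num.min ?u ?v] => case: (lerP u v) => ? end);
  repeat (match goal with |- context [Num.max ?u ?v] => case: (lerP u v) => ? end).

Lemma tent_ge0 a b x : 0 <= tent a b x.
Proof. by rewrite /tent le_max lexx. Qed.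

Lemma tent_lip a b x y : `|tent a b x - tent a b y| <= `|x - y|.
Proof.
rewrite /tent ler_norml; have := ler_norm (x - y); have := lerNnormlW (lexx `|x - y|).
by minmax => *; apply/andP; split; lra.
Qed.

Lemma tent_gt0 a b x : 0 < tent a b x -> a < x < b.
Proof. by rewrite /tent; minmax => *; apply/andP; split; lra. Qed.

Lemma odd_tentN a b x : odd_tent a b (- x) = - odd_tent a b x.
Proof. by rewrite /odd_tent opprK opprB. Qed.

Lemma odd_tentE a b x : 0 <= a -> 0 <= x -> odd_tent a b x = tent a b x.
Proof.
move=> a0 x0; rewrite /odd_tent; have [h|h] := leP (tent a b (- x)) 0.
  by rewrite (_ : tent a b (- x) = 0) ?subr0 //; apply/le_anti; rewrite h tent_ge0.
by have := tent_gt0 h => /andP[]; lra.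
Qed.

Lemma odd_tent_sqr a b x : 0 <= a -> odd_tent a b x ^+ 2 = tent a b `|x| ^+ 2.
Proof.
move=> a0; case: (ger0P x) => x0; first by rewrite odd_tentE.
by rewrite -sqrrN -odd_tentN odd_tentE // oppr_ge0 ltW.
Qed.

Lemma tent_le a b x : 0 <= a -> 0 <= x -> tent a b x <= x.
Proof. by rewrite /tent; minmax; lra. Qed.

(** Across 0 the two tents add up instead of cancelling; there [tent_le] bounds each by the distance
    to 0. *)
Lemma odd_tent_lip a b x y : 0 <= a -> `|odd_tent a b x - odd_tent a b y| <= `|x - y|.
Proof.
move=> a0.
have pos u v : 0 <= u -> 0 <= v -> `|odd_tent a b u - odd_tent a b v| <= `|u - v|.
  by move=> u0 v0; rewrite !odd_tentE //; exact: tent_lip.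
have mixed u v : 0 <= u -> 0 <= v -> `|odd_tent a b u + odd_tent a b v| <= `|u + v|.
  move=> u0 v0; rewrite !odd_tentE // !ger0_norm ?addr_ge0 ?tent_ge0 //.
  by rewrite lerD ?tent_le.
have [x0|/ltW x0] := leP 0 x; have [y0|/ltW y0] := leP 0 y.
- exact: pos.
- by have := mixed x (- y); rewrite odd_tentN oppr_ge0; apply.
- rewrite distrC [leRHS]distrC; have := mixed (- x) y.
  by rewrite odd_tentN oppr_ge0 ![- _ + _]addrC; apply.
- rewrite distrC [leRHS]distrC; have := pos (- x) (- y).
  by rewrite !odd_tentN !oppr_ge0 !opprK ![- _ + _]addrC; apply.
Qed.

Lemma thr_dist_ge0 x b T : 0 <= thr_dist x b T.
Proof. by elim: T b => [|t T IH] b //=; rewrite le_min normr_ge0 IH. Qed.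

Lemma thr_dist_left x b T : x <= b -> path <=%R b T -> thr_dist x b T = b - x.
Proof.
elim: T b => [|t T IH] b xb /=; first by rewrite ler0_norm ?opprB // subr_le0.
by move=> /andP[bt p]; rewrite IH // ?(le_trans xb) // ler0_norm ?subr_le0 //; minmax; lra.
Qed.

Lemma thr_pot_left x b T : x <= b -> path <=%R b T -> thr_pot x b T = 0.
Proof.
elim: T b => [|t T IH] b xb /=.
  move=> _; have -> : Num.max 0 (x - b) = 0 by (minmax; lra).
  by rewrite expr0n mul0r.
move=> /andP[bt p]; rewrite IH // ?(le_trans xb) // /bump addr0.
have -> : clamp (t - b) (x - b) = 0 by rewrite /clamp; minmax; lra.
by rewrite !expr0n /= !mul0r subrr.
Qed.

(** The difference is the integral over [c, c'] of y * (L - y) / L, which is at most y, hence at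
    most c', and at most L - y, hence at most L - c. *)
Lemma bump_core L c c' : 0 <= c -> c <= c' -> c' <= L ->
  [/\ 0 <= (c' ^+ 2 / 2 - c' ^+ 3 / (3 * L)) - (c ^+ 2 / 2 - c ^+ 3 / (3 * L)),
      (c' ^+ 2 / 2 - c' ^+ 3 / (3 * L)) - (c ^+ 2 / 2 - c ^+ 3 / (3 * L)) <= (c' - c) * c' &
      (c' ^+ 2 / 2 - c' ^+ 3 / (3 * L)) - (c ^+ 2 / 2 - c ^+ 3 / (3 * L)) <= (c' - c) * (L - c)].
Proof.
move=> c0 cc cL.
have [L0|L0] := eqVneq L 0.
  have c1 : c = 0 by lra. have c2 : c' = 0 by lra.
  by rewrite c1 c2 L0; split; lra.
have Lp : 0 < L by rewrite lt_def L0 /=; lra.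
have -> : (c' ^+ 2 / 2 - c' ^+ 3 / (3 * L)) - (c ^+ 2 / 2 - c ^+ 3 / (3 * L)) =
   (c' - c) * ((3 * L * (c' + c) - 2 * (c' ^+ 2 + c' * c + c ^+ 2)) / (6 * L)).
  by field.
have d0 : 0 <= c' - c by lra.
split; first by apply: mulr_ge0 => //; apply: divr_ge0; nra.
  by apply: ler_wpM2l => //; rewrite ler_pdivrMr; nra.
by apply: ler_wpM2l => //; rewrite ler_pdivrMr; nra.
Qed.

Lemma clampP L c : 0 <= L ->
  [\/ c <= 0 /\ clamp L c = 0, 0 <= c <= L /\ clamp L c = c | L <= c /\ clamp L c = L].
Proof.
rewrite /clamp => L0; have [cL|/ltW Lc] := leP c L.
  have [c0|/ltW c0] := leP 0 c; last by constructor 1.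
  by constructor 2; split=> //; apply/andP.
by constructor 3; rewrite (max_idPr L0).
Qed.

Lemma bump_ge L c : 0 <= c <= L -> c ^+ 2 / 6 <= bump L c.
Proof.
move=> /andP[c0 cL]; have L0 : 0 <= L by lra.
have -> : bump L c = c ^+ 2 / 2 - c ^+ 3 / (3 * L).
  by rewrite /bump; have [[? ->]|[? ->]|[? ->]] := clampP c L0 => //; congr (_ ^+ 2 / 2 - _ ^+ 3 / _); lra.
have [Lz|Lz] := eqVneq L 0.
  have -> : c = 0 by lra. by rewrite !expr0n /= !mul0r subrr.
have Lp : 0 < L by rewrite lt_def Lz.
have -> : c ^+ 3 / (3 * L) = c ^+ 2 * (c / L) / 3 by field.
have : c ^+ 2 * (c / L) <= c ^+ 2 * 1.
  by apply: ler_wpM2l; rewrite ?sqr_ge0 // ler_pdivrMr // mul1r.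
by lra.
Qed.

(** A full gap of length a contributes at least a^2 / 6. The gaps are combined by Cauchy-Schwarz in
    the form (a + c)^2 / (1 + K) <= a^2 + c^2 / K, which is why the loss is linear in the number of
    thresholds. *)
Lemma thr_pot_ge x b T : b <= x -> path <=%R b T ->
  (x - b) ^+ 2 / (6 * (size T).+1%:R) <= thr_pot x b T.
Proof.
elim: T b => [|t T IH] b bx /=.
  move=> _; have -> : Num.max 0 (x - b) = x - b by (minmax; lra).
  by have := sqr_ge0 (x - b); lra.
move=> /andP[bt p]; have [xt|tx] := leP x t.
  rewrite thr_pot_left // addr0; apply: le_trans (bump_ge _); last by lra.
  rewrite ler_pdivrMr; last by rewrite mulr_gt0 // ltr0n.
  have : 1 <= (size T).+2%:R :> R by rewrite ler1n.
  have := sqr_ge0 (x - b); set u := _ ^+ 2; set K := _%:R; nra.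
have := IH t (ltW tx) p; have := @bump_ge (t - b) (t - b).
have -> : bump (t - b) (x - b) = bump (t - b) (t - b).
  have L0 : 0 <= t - b by lra.
  rewrite /bump; congr (_ ^+ 2 / 2 - _ ^+ 3 / _);
  by have [[? ->]|[? ->]|[? ->]] := clampP (x - b) L0;
     have [[? ->]|[? ->]|[? ->]] := clampP (t - b) L0; lra.
rewrite lexx subr_ge0 bt => /(_ isT); set u := bump _ _; set v := thr_pot _ _ _.
rewrite [(size T).+2%:R]mulrS; set K := (size T).+1%:R.
have K0 : 0 < K by rewrite ltr0n.
move=> h1 h2; apply: le_trans (lerD h1 h2).
rewrite -subr_ge0.
have -> : (t - b) ^+ 2 / 6 + (x - t) ^+ 2 / (6 * K) - (x - b) ^+ 2 / (6 * (1 + K)) =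
   ((t - b) * K - (x - t)) ^+ 2 / (6 * K * (1 + K)).
  by field; apply/andP; split; lra.
by apply: divr_ge0; rewrite ?sqr_ge0 //; nra.
Qed.

(** The integrand is at most the distance to the nearer end of [0, L], and a point of [c, c'] is
    within c' - c of c'. So [D] need only bound that distance at c', and only when c' is
    interior. *)
Lemma bump_incr L c c' D : 0 <= L -> c <= c' -> 0 <= D ->
  (0 < c' < L -> c' <= D \/ L - c' <= D) ->
  0 <= bump L c' - bump L c <= (clamp L c' - clamp L c) * (D + (c' - c)).
Proof.
move=> L0 cc D0 hD; rewrite /bump.
have [d0 dd dL dc] : [/\ 0 <= clamp L c, clamp L c <= clamp L c', clamp L c' <= L &
    clamp L c' - clamp L c <= c' - c].
  by have [[? ->]|[? ->]|[? ->]] := clampP c L0;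
     have [[? ->]|[? ->]|[? ->]] := clampP c' L0; split; lra.
have [-> h2 h3] := bump_core d0 dd dL; rewrite /=.
have bound e : clamp L c <= clamp L c' -> e <= D + (c' - c) ->
    (clamp L c' - clamp L c) * e <= (clamp L c' - clamp L c) * (D + (c' - c)).
  by move=> h e1; apply: ler_wpM2l => //; rewrite subr_ge0.
have [[h e]|[/andP[h hL] e]|[h e]] := clampP c' L0.
- have -> : clamp L c = 0 by lra.
  by rewrite e expr0n /= !mul0r !subrr !mul0r.
- have [cz|cz] := eqVneq c' 0.
    have z : clamp L c = 0 by lra.
    by move: h2; rewrite e cz z; lra.
  have [cz'|cz'] := eqVneq c' L.
    by apply: le_trans h3 (bound _ dd _); rewrite e in dc; lra.
  case: hD; first by rewrite !lt_def cz h eq_sym cz'.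
    by move=> hD; apply: le_trans h2 (bound _ dd _); lra.
  by move=> hD; apply: le_trans h3 (bound _ dd _); rewrite e in dc;
     have [[? ?]|[? ?]|[? ?]] := clampP c L0; lra.
- by apply: le_trans h3 (bound _ dd _); lra.
Qed.

(** The derivative of mu is at most the distance to the thresholds, which is 1-Lipschitz. The maxima
    with [b] record that mu is flat to the left of [b], and they make the bounds for successive gaps
    add up. *)
Lemma thr_pot_incr x y b T : path <=%R b T -> y <= x ->
  0 <= thr_pot x b T - thr_pot y b T <=
  (Num.max b x - Num.max b y) * (thr_dist x b T + (x - y)).
Proof.
elim: T b => [|t T IH] b /=.
  move=> _ yx; have := ler_norm (x - b); set D := `|_|.
  have [xb|/ltW xb] := leP x b.
    have yb : y <= b by lra.
    have -> : Num.max 0 (x - b) = 0 by (minmax; lra).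
    have -> : Num.max 0 (y - b) = 0 by (minmax; lra).
    by rewrite ?(max_idPl yb) !subrr mul0r lexx.
  have -> : Num.max 0 (x - b) = x - b by (minmax; lra).
  have [yb|/ltW yb] := leP y b.
    have -> : Num.max 0 (y - b) = 0 by (minmax; lra).
    by rewrite expr0n mul0r subr0 => h; apply/andP; split; nra.
  have -> : Num.max 0 (y - b) = y - b by (minmax; lra).
  by move=> h; apply/andP; split; nra.
move=> /andP[bt p] yx; have /andP[g0 g1] := IH t p yx.
set D := Num.min _ _.
have D0 : 0 <= D by rewrite le_min normr_ge0 thr_dist_ge0.
have hD : 0 < x - b < t - b -> x - b <= D \/ t - b - (x - b) <= D.
  move=> /andP[xb xt]; rewrite /D thr_dist_left //; last by lra.
  by rewrite gtr0_norm //; case: (lerP (x - b) (t - x)) => h; [left|right]; lra.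
have L0 : 0 <= t - b by lra.
have yx' : y - b <= x - b by lra.
have /andP[f0 f1] := bump_incr L0 yx' D0 hD.
apply/andP; split; first by lra.
(* Including [b] among the thresholds does not lower the distance here: if x > t then t is closer to
   x than [b] is, and otherwise both sides vanish. *)
have {g1} g1 : thr_pot x t T - thr_pot y t T <= (Num.max t x - Num.max t y) * (D + (x - y)).
  case: (boolP (x <= t)) => [xt|]; last rewrite -ltNge => xt.
    have yt := le_trans yx xt.
    by rewrite !thr_pot_left // (max_idPl xt) (max_idPl yt) !subrr mul0r.
  apply: le_trans g1 _; apply: ler_wpM2l; first by minmax; lra.
  rewrite lerD2r /D; have dt : thr_dist x t T <= `|x - t|.
    by case: (T) => [|? ?] //=; rewrite ge_min lexx.
  move: dt; rewrite !gtr0_norm; [|lra|lra]; set z := thr_dist _ _ _.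
  by case: (lerP (x - b) z); lra.
have maxE z : Num.max b z = b + clamp (t - b) (z - b) + (Num.max t z - t).
  have [[? ->]|[? ->]|[? ->]] := clampP (z - b) L0;
  by case: (lerP b z); case: (lerP t z); lra.
rewrite !maxE.
have -> : b + clamp (t - b) (x - b) + (Num.max t x - t) -
    (b + clamp (t - b) (y - b) + (Num.max t y - t)) =
  (clamp (t - b) (x - b) - clamp (t - b) (y - b)) + (Num.max t x - Num.max t y) by ring.
by rewrite mulrDl; lra.
Qed.

Lemma thr_dist_tent x a b T : a <= x <= b -> thr_dist x a (b :: T) <= tent a b x.
Proof.
move=> /andP[ax xb] /=.
have h : thr_dist x b T <= b - x.
  have -> : b - x = `|x - b| by rewrite ler0_norm ?opprB // subr_le0.
  by case: T => [|? ?] //=; rewrite ge_min lexx.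
move: h; rewrite ger0_norm ?subr_ge0 // /tent; set D := thr_dist _ _ _.
by minmax => *; lra.
Qed.

Lemma thr_dist_cons x a b T : thr_dist x a (b :: T) <= thr_dist x b T.
Proof. by rewrite /= ge_min lexx orbT. Qed.

(* Greedy choice: the next threshold is the first value [t = a v] for which the
   tent over [b, t] has mass at least [C]; its predecessor [p] among the values
   of [a] is also taken as a threshold, since the mass may jump at [t]. *)
Lemma thresholds_or_bands (I : finType) (d a : I -> R) (C : R) :
  (forall u, 0 <= d u) -> 0 < C -> forall n b,
  (exists T, [/\ path <=%R b T, (size T <= 2 * n)%nat &
     \sum_(u | b <= a u) d u * thr_dist (a u) b T ^+ 2 <= n%:R * C]) \/
  (exists B : seq (R * R), [/\ size B = n, pairwise (fun p q => p.2 <= q.1) B,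
     {in B, forall p, b <= p.1 <= p.2} &
     {in B, forall p, C <= \sum_u d u * tent p.1 p.2 (a u) ^+ 2}]).
Proof.
move=> d0 C0; elim=> [|n IH] b; first by right; exists [::].
pose m t := \sum_u d u * tent b t (a u) ^+ 2.
have dE u (y z : R) : 0 <= y -> y <= z -> d u * y ^+ 2 <= d u * z ^+ 2.
  by move=> y0 yz; apply: ler_wpM2l => //; rewrite ler_sqr // nnegrE (le_trans y0).
have dt0 u (y : R) : 0 <= d u * y ^+ 2 by rewrite mulr_ge0 ?sqr_ge0.
have small t : m t < C -> \sum_(u | b <= a u <= t) d u * tent b t (a u) ^+ 2 <= C.
  move=> /ltW; apply: le_trans; rewrite /m [leRHS](bigID (fun u => b <= a u <= t)) /=.
  by rewrite lerDl sumr_ge0.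
have [v0 /andP[bv0 Cv0]|none] := pickP [pred v | (b <= a v) && (C <= m (a v))]; last first.
  (* No tent starting at [b] reaches mass [C] any more, so the largest value closes the list and a
     single [C] pays for everything to the right of [b]. *)
  left; have [u0 bu0|empty] := pickP [pred u | b <= a u]; last first.
    exists [::]; split=> //; rewrite big_pred0 ?mulr_ge0 // ltW //.
  have [v bv vmax] := @arg_maxP _ _ I u0 [pred u | b <= a u] a bu0.
  exists [:: a v]; split; [by rewrite /= andbT|by rewrite mulnS|].
  have mC : m (a v) < C by have /negbT := none v; rewrite /= [b <= a v]bv /= -ltNge.
  apply: le_trans (_ : C <= _); last by rewrite ler_peMl ?ler1n // ltW.
  apply: le_trans (small _ mC).
  rewrite [leRHS](eq_bigl (fun u => b <= a u)); last first.
    by move=> u; case: (boolP (b <= a u)) => //= bu; exact: vmax.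
  apply: ler_sum => u bu; apply: dE; first exact: thr_dist_ge0.
  by apply: thr_dist_tent; rewrite bu; exact: vmax.
have := @arg_minP _ _ I v0 [pred v | (b <= a v) && (C <= m (a v))] a.
rewrite /= bv0 Cv0 => /(_ isT); case=> v /andP[bv Cv] vmin.
have {IH} [[T [pT sT eT]]|[B [sB pB bB CB]]] := IH (a v); last first.
  right; exists ((b, a v) :: B); split=> /=.
  - by rewrite sB.
  - by rewrite pB andbT; apply/allP => p /bB /andP[].
  - move=> p; rewrite inE => /orP[/eqP -> /=|/bB /andP[h ->]]; first by rewrite lexx bv.
    by rewrite (le_trans bv).
  - by move=> p; rewrite inE => /orP[/eqP -> //|/CB].
left.
have [p [bp pv pC]] : exists p, [/\ b <= p, p <= a v &
   \sum_(u | (b <= a u) && (a u < a v)) d u * thr_dist (a u) b (p :: a v :: T) ^+ 2 <= C].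
  have [u0 /andP[bu0 uv0]|empty] := pickP [pred u | (b <= a u) && (a u < a v)]; last first.
    by exists b; split=> //; rewrite big_pred0 // ltW.
  have := @arg_maxP _ _ I u0 [pred u | (b <= a u) && (a u < a v)] a.
  rewrite /= bu0 uv0 => /(_ isT); case=> u1 /andP[bu1 u1v] umax.
  have mC : m (a u1) < C.
    rewrite ltNge; apply/negP => h; have := vmin u1; rewrite /= bu1 h => /(_ isT).
    by rewrite leNgt u1v.
  exists (a u1); split; [by []|exact: ltW|].
  apply: le_trans (small _ mC).
  rewrite [leRHS](eq_bigl (fun u => (b <= a u) && (a u < a v))); last first.
    move=> u; apply/andP/andP => -[h1 h2]; split=> //; first exact: le_lt_trans u1v.
    by apply: umax; rewrite /= h1.
  apply: ler_sum => u bu; apply: dE.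
    exact: (thr_dist_ge0 _ _ [:: _, _ & T]).
  by apply: (thr_dist_tent (_ :: T)); case/andP: (bu) => -> _; exact: umax.
exists (p :: a v :: T); split; first by rewrite /= bp pv.
  by rewrite /=; lia.
rewrite (bigID (fun u => a u < a v)) /= mulrS mulrDl mul1r; apply: lerD; first exact: pC.
apply: le_trans eT; rewrite [leRHS](eq_bigl (fun u => (b <= a u) && ~~ (a u < a v))).
  apply: ler_sum => u _; apply: dE; first exact: (thr_dist_ge0 _ _ [:: _, _ & T]).
  exact: le_trans (thr_dist_cons _ _ _ (_ :: T)) (thr_dist_cons _ _ _ T).
by move=> u; rewrite -leNgt; apply/idP/andP => [h|[]//]; rewrite h (le_trans bv).
Qed.

End OneDim.

(** * Sweep cuts *)

Definition level_sign (R : realFieldType) (t x : R) : R :=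
  (if t < x then 1 else 0) - (if x < - t then 1 else 0).

Section LevelSign.
Variable R : realFieldType.

Lemma level_sign_case (t x : R) : 0 <= t ->
  [\/ t < x /\ level_sign t x = 1, x < - t /\ level_sign t x = - 1
    | `|x| <= t /\ level_sign t x = 0].
Proof.
rewrite /level_sign => t0; case: ifP => tx.
  have -> /= : (x < - t) = false by lra.
  by constructor 1; rewrite subr0.
have {tx}tx : x <= t by rewrite leNgt tx.
case: ifP => xt; first by constructor 2; rewrite sub0r.
by constructor 3; rewrite subr0 ler_norml tx leNgt xt.
Qed.

(** Here [al] is the lowest nonzero level: subtracting it from |x| never overshoots 0, so nothing is
    lost. *)
Lemma level_sign_abs (al x : R) : 0 < al -> (x = 0 \/ al <= `|x|) ->
  `|x| = `|x - al * level_sign 0 x| + al * `|level_sign 0 x|.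
Proof.
move=> al0; have [[h ->]|[h ->]|[h ->]] := level_sign_case x (lexx 0); rewrite ?normrN ?normr1 ?normr0.
- rewrite (gtr0_norm h) => -[?|?]; first by lra.
  by rewrite ger0_norm; lra.
- rewrite oppr0 in h; rewrite (ltr0_norm h) => -[?|?]; first by lra.
  by rewrite ler0_norm; lra.
- by rewrite !mulr0 subr0 addr0.
Qed.

(** The two parts never cancel: for opposite signs the level part is 0, and otherwise both parts
    have the sign of x + y, or are 0. *)
Lemma level_sign_abs2 (al x y : R) : 0 < al -> (x = 0 \/ al <= `|x|) ->
  (y = 0 \/ al <= `|y|) ->
  `|x + y| = `|(x - al * level_sign 0 x) + (y - al * level_sign 0 y)| +
     al * `|level_sign 0 x + level_sign 0 y|.
Proof.
have h0 := lexx (0 : R); move=> al0.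
have [[hx ->]|[hx ->]|[hx ->]] := level_sign_case x h0;
have [[hy ->]|[hy ->]|[hy ->]] := level_sign_case y h0; rewrite ?oppr0 in hx hy *.
- rewrite (gtr0_norm hx) (gtr0_norm hy) => -[?|?] -[?|?]; try lra.
  by rewrite !ger0_norm; lra.
- rewrite (gtr0_norm hx) (ltr0_norm hy) => -[?|?] -[?|?]; try lra.
  rewrite subrr normr0 mulr0 addr0; congr `|_|; lra.
- rewrite (gtr0_norm hx) => -[?|?] _; first lra.
  have -> : y = 0 by apply/eqP; rewrite -normr_le0.
  by rewrite !mulr0 subr0 !addr0 normr1 !ger0_norm; lra.
- rewrite (ltr0_norm hx) (gtr0_norm hy) => -[?|?] -[?|?]; try lra.
  rewrite addNr normr0 mulr0 addr0; congr `|_|; lra.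
- rewrite (ltr0_norm hx) (ltr0_norm hy) => -[?|?] -[?|?]; try lra.
  by rewrite !ler0_norm; lra.
- rewrite (ltr0_norm hx) => -[?|?] _; first lra.
  have -> : y = 0 by apply/eqP; rewrite -normr_le0.
  by rewrite !mulr0 subr0 !addr0 normrN normr1 !ler0_norm; lra.
- move=> _; rewrite (gtr0_norm hy) => -[?|?]; first lra.
  have -> : x = 0 by apply/eqP; rewrite -normr_le0.
  by rewrite !mulr0 subr0 !add0r normr1 !ger0_norm; lra.
- move=> _; rewrite (ltr0_norm hy) => -[?|?]; first lra.
  have -> : x = 0 by apply/eqP; rewrite -normr_le0.
  by rewrite !mulr0 subr0 !add0r normrN normr1 !ler0_norm; lra.
- by rewrite addr0 normr0 !mulr0 !subr0 addr0.
Qed.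

Lemma level_sign_shift (al t x : R) : 0 < al -> 0 <= t -> (x = 0 \/ al <= `|x|) ->
  level_sign t (x - al * level_sign 0 x) = level_sign (t + al) x.
Proof.
move=> al0 t0 hx.
suff [E1 E2] : (t < x - al * level_sign 0 x) = (t + al < x) /\
    (x - al * level_sign 0 x < - t) = (x < - (t + al)).
  by rewrite [LHS]/level_sign [RHS]/level_sign E1 E2.
have [[h ->]|[h ->]|[h ->]] := level_sign_case x (lexx 0).
- by split; apply/idP/idP; case: hx => [?|]; rewrite ?(gtr0_norm h) => *; lra.
- rewrite oppr0 in h.
  by split; apply/idP/idP; case: hx => [?|]; rewrite ?(ltr0_norm h) => *; lra.
- have -> : x = 0 by apply/eqP; rewrite -normr_le0.
  by split; apply/idP/idP => ?; lra.
Qed.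

End LevelSign.

Section Sweep.
Variables (N : nat) (w : 'I_N -> 'I_N -> R).
Hypothesis wG : weighted_graph w.
Hypothesis d_gt0 : forall u, 0 < deg w u.

Let wC : forall u v, w u v = w v u. Proof. by case: wG. Qed.
Let w_ge0 : forall u v, 0 <= w u v. Proof. by case: wG => _ []. Qed.

Definition dual_var (f : 'I_N -> R) := \sum_u \sum_v w u v * `|f u + f v|.
Definition mass1 (f : 'I_N -> R) := \sum_u deg w u * `|f u|.

Lemma mass1_ge0 f : 0 <= mass1 f.
Proof. by apply: sumr_ge0 => u _; rewrite mulr_ge0 // ltW. Qed.

Lemma mass1_gt0 f u : f u != 0 -> 0 < mass1 f.
Proof.
move=> fu; rewrite /mass1 (bigD1 u) //= ltr_pwDl //.
  by rewrite mulr_gt0 // normr_gt0.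
by apply: sumr_ge0 => v _; rewrite mulr_ge0 // ltW.
Qed.

(* Layer-cake decomposition of [H], peeling off one level at a time. *)
Lemma dual_coarea (H : 'I_N -> R) : (exists u, H u != 0) ->
  exists t, [/\ 0 <= t, exists u, t < `|H u| &
    dual_var (fun u => level_sign t (H u)) * mass1 H <=
    dual_var H * mass1 (fun u => level_sign t (H u))].
Proof.
have [n] := ubnP #|[set u | H u != 0]|; elim: n H => // n IH H.
rewrite ltnS => Hn [u0 Hu0].
have := @arg_minP _ _ 'I_N u0 (fun u => H u != 0) (fun u => `|H u|) Hu0.
case=> u1 Hu1 umin; set al := `|H u1| in umin.
have al0 : 0 < al by rewrite normr_gt0.
have dich u : H u = 0 \/ al <= `|H u|.
  by have [->|/umin] := eqVneq (H u) 0; [left|right].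
pose Z u := level_sign 0 (H u); pose H' u := H u - al * Z u.
have eNum : dual_var H = dual_var H' + al * dual_var Z.
  rewrite /dual_var mulr_sumr -big_split; apply: eq_bigr => u _.
  rewrite mulr_sumr -big_split; apply: eq_bigr => v _ /=.
  by rewrite (level_sign_abs2 al0 (dich u) (dich v)) mulrDr mulrCA.
have eDen : mass1 H = mass1 H' + al * mass1 Z.
  rewrite /mass1 mulr_sumr -big_split; apply: eq_bigr => u _ /=.
  by rewrite (level_sign_abs al0 (dich u)) mulrDr mulrCA.
have [good|bad] := leP (dual_var Z * mass1 H) (dual_var H * mass1 Z).
  by exists 0; split=> //; exists u0; rewrite normr_gt0.
have [/existsP H'n|] := boolP [exists u, H' u != 0]; last first.
  rewrite negb_exists => /forallP H'0.
  have z u : H' u = 0 by apply/eqP; have := H'0 u; rewrite negbK.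
  have n0 : dual_var H' = 0.
    by rewrite /dual_var big1 // => u _; rewrite big1 // => v _; rewrite !z addr0 normr0 mulr0.
  have m0 : mass1 H' = 0 by rewrite /mass1 big1 // => u _; rewrite z normr0 mulr0.
  by move: bad; rewrite eNum eDen n0 m0 !add0r -mulrA mulrCA ltxx.
have [|t [t0 [u tu] ht]] := IH H' _ H'n.
  apply: leq_trans Hn; apply: proper_card; apply/properP; split.
    apply/subsetP => u; rewrite !inE; apply: contraNN => /eqP Hu.
    by rewrite /H' /Z Hu /level_sign oppr0 ltxx subrr mulr0 subrr.
  exists u1; rewrite !inE ?negbK // /H' /Z.
  have [[h ->]|[h ->]|[h ->]] := level_sign_case (H u1) (lexx 0).
  - by rewrite mulr1 /al gtr0_norm // subrr.
  - by rewrite oppr0 in h; rewrite mulrN1 opprK /al ltr0_norm // subrr.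
  - by move: h; rewrite normr_le0 (negbTE Hu1).
have sh v : level_sign t (H' v) = level_sign (t + al) (H v) by exact: level_sign_shift.
exists (t + al); split; first by rewrite addr_ge0 // ltW.
  exists u; rewrite (level_sign_abs al0 (dich u)) -/(Z u) -/(H' u).
  have [[h e]|[h e]|[h e]] := level_sign_case (H u) (lexx 0); rewrite /Z e ?normrN ?normr1 ?mulr1; try lra.
  have Hu : H u = 0 by apply/eqP; rewrite -normr_le0.
  by move: tu; rewrite /H' /Z e Hu mulr0 subr0 normr0; lra.
have eT : dual_var (fun u => level_sign t (H' u)) = dual_var (fun u => level_sign (t + al) (H u)).
  by rewrite /dual_var; do 2![apply: eq_bigr => ? _]; rewrite !sh.
have eM : mass1 (fun u => level_sign t (H' u)) = mass1 (fun u => level_sign (t + al) (H u)).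
  by rewrite /mass1; apply: eq_bigr => ? _; rewrite sh.
rewrite eT eM in ht; case: H'n => u2 Hu2; have Den'0 := mass1_gt0 Hu2.
have DT := mass1_ge0 (fun u => level_sign (t + al) (H u)).
rewrite -(ler_pM2r Den'0).
have DH : 0 <= mass1 H := mass1_ge0 H.
(* Mediant inequality: the level [Z] has a larger ratio than [H], so what remains after removing it
   has at most the ratio of [H]. *)
have key : dual_var H' * mass1 H <= dual_var H * mass1 H'.
  by move: bad; rewrite eNum eDen; move: al0; clear; set A := dual_var H';
     set B := dual_var Z; set C := mass1 H'; set D := mass1 Z; nra.
have k1 := ler_wpM2r DH ht; have k2 := ler_wpM2r DT key.
move: k1 k2; set A := dual_var _; set B := mass1 _; set C := mass1 _.
by set D := dual_var H'; set F := mass1 _; set G := dual_var H; lra.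
Qed.

(** Edge by edge, with Z the level sign, |Z u + Z v| equals |Z u| + |Z v|, minus 2 when u and v lie
    on opposite sides. *)
Lemma phibar_level (H : 'I_N -> R) (t : R) : 0 <= t -> (exists u, t < `|H u|) ->
  let V1 := [set u | t < H u] in let V2 := [set u | H u < - t] in
  [/\ [disjoint V1 & V2], V1 :|: V2 != set0 &
  (1 - phibar w V1 V2) * (2 * mass1 (fun u => level_sign t (H u))) =
    dual_var (fun u => level_sign t (H u))].
Proof.
move=> t0 [u0 tu0] V1 V2; set Z := fun u => level_sign t (H u).
have dis u : u \in V1 -> u \in V2 -> false.
  by rewrite !inE; lra.
have ZE u : Z u = (u \in V1)%:R - (u \in V2)%:R.
  by rewrite /Z /level_sign !inE; case: ifP; case: ifP.
have absZ u : `|Z u| = (u \in V1 :|: V2)%:R.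
  rewrite ZE in_setU; have := dis u; case: (u \in V1); case: (u \in V2) => //=.
  - by move=> /(_ isT isT).
  - by rewrite subr0 normr1.
  - by rewrite sub0r normrN normr1.
  - by rewrite subr0 normr0.
have volE : mass1 Z = vol w (V1 :|: V2).
  rewrite /mass1 /vol [RHS]big_mkcond; apply: eq_bigr => u _; rewrite absZ.
  by case: (u \in _); rewrite ?mulr1 ?mulr0.
have ne : V1 :|: V2 != set0.
  apply/set0Pn; exists u0; rewrite !inE; move: tu0; rewrite ltr_normr.
  by case/orP => [->//|h]; rewrite (_ : H u0 < - t) ?orbT //; lra.
split=> //.
  by rewrite disjoint_subset; apply/subsetP => u u1; rewrite inE; apply/negP => /(dis _ u1).
have vol0 : mass1 Z != 0.
  by rewrite gt_eqF //; case/set0Pn: ne => u uV; apply: (@mass1_gt0 _ u); rewrite -normr_gt0 absZ uV ltr01.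
have cutE : cut w V1 V2 = \sum_u \sum_v w u v * ((u \in V1)%:R * (v \in V2)%:R).
  rewrite /cut big_mkcond; apply: eq_bigr => u _; case: (u \in V1); last first.
    by rewrite big1 // => v _; rewrite mul0r mulr0.
  by rewrite big_mkcond; apply: eq_bigr => v _; case: (v \in V2); rewrite mul1r ?mulr1 ?mulr0.
(* Both orientations of the cut are needed, since the edgewise identity is summed over ordered
   pairs. *)
have cutE' : cut w V1 V2 = \sum_u \sum_v w u v * ((u \in V2)%:R * (v \in V1)%:R).
  rewrite cutE exchange_big; do 2![apply: eq_bigr => ? _].
  by rewrite wC [X in _ * X]mulrC.
rewrite /phibar -volE.
have -> : (1 - 2 * cut w V1 V2 / mass1 Z) * (2 * mass1 Z) =
   mass1 Z + mass1 Z - 2 * cut w V1 V2 - 2 * cut w V1 V2 by field.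
rewrite {1}cutE cutE' {1}/mass1 -(sum_deg w) /mass1 -(sum_deg_sym wG) !mulr_sumr.
rewrite -big_split -!sumrB; apply: eq_bigr => u _ /=.
rewrite !mulr_sumr -big_split -!sumrB; apply: eq_bigr => v _ /=.
rewrite !absZ !ZE !in_setU; have := dis u; have := dis v.
case: (u \in V1); case: (u \in V2) => //= d1 d2; do ?[by have := d2 isT isT];
case: (v \in V1) d1; case: (v \in V2) => //= d1; do ?[by have := d1 isT isT];
rewrite ?mulr0n ?mulr1n ?subr0 ?sub0r ?oppr0 ?addr0 ?add0r ?subrr ?addNr ?normrN ?normr1 ?normr0; try lra.
- by rewrite ger0_norm; lra.
- by rewrite ler0_norm; lra.
Qed.
End Sweep.

Section TwoSupports.
Variables (R : realFieldType) (I : finType).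

Lemma single_support (x : I) (p : I -> R) :
  (forall i j, i != j -> p i * p j = 0) -> exists i0, forall i, i != i0 -> p i = 0.
Proof.
move=> pp; have [i0 pi0|p0] := pickP (fun i => p i != 0).
  by exists i0 => i ii; have /eqP := pp _ _ ii; rewrite mulf_eq0 (negbTE pi0) orbF => /eqP.
by exists x => i _; have /negbFE/eqP := p0 i.
Qed.

(** Meant for one edge: [p] and [q] list the values of a disjointly supported family at its two
    ends. At most two members are nonzero on the edge, whence the factor 2. *)
Lemma two_supports (p q : I -> R) :
  (forall i j, i != j -> p i * p j = 0) -> (forall i j, i != j -> q i * q j = 0) ->
  (\sum_i (p i + q i)) ^+ 2 <= 2 * \sum_i (p i + q i) ^+ 2 /\
  (forall D, 0 <= D -> (forall i, (p i + q i) ^+ 2 <= D) -> \sum_i (p i + q i) ^+ 2 <= 2 * D).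
Proof.
move=> pp qq; have [x _|I0] := pickP (mem I); last first.
  by rewrite !big_pred0 // expr0n mulr0; split=> // D D0 _; rewrite mulr_ge0.
have [i0 p0] := single_support x pp; have [j0 q0] := single_support x qq.
have [ij|ij] := eqVneq j0 i0.
  have z i : i != i0 -> p i + q i = 0 by move=> h; rewrite p0 ?q0 ?addr0 ?ij.
  have -> : \sum_i (p i + q i) = p i0 + q i0 by rewrite (bigD1 i0) //= big1 ?addr0.
  have E : \sum_i (p i + q i) ^+ 2 = (p i0 + q i0) ^+ 2.
    by rewrite (bigD1 i0) //= big1 ?addr0 // => i /z ->; rewrite expr0n.
  rewrite E; have h := sqr_ge0 (p i0 + q i0); split; first by lra.
  by move=> D D0 hD; have := hD i0; lra.
have z i : (i != i0) && (i != j0) -> p i + q i = 0.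
  by move=> /andP[h1 h2]; rewrite p0 ?q0 ?addr0.
have E : \sum_i (p i + q i) ^+ 2 = (p i0 + q i0) ^+ 2 + (p j0 + q j0) ^+ 2.
  rewrite (bigD1 i0) //= (bigD1 j0) //= big1 ?addr0 // => i /z ->.
  by rewrite expr0n.
rewrite E (bigD1 i0) //= (bigD1 j0) //= big1 ?addr0 //.
split; last by move=> D D0 hD; have := hD i0; have := hD j0; lra.
by move: (p i0 + q i0) (p j0 + q j0) => a b; have := sqr_ge0 (a - b); lra.
Qed.

Lemma sqr_sum_disjoint (p : I -> R) :
  (forall i j, i != j -> p i * p j = 0) -> (\sum_i p i) ^+ 2 = \sum_i p i ^+ 2.
Proof.
move=> pp; rewrite expr2 mulr_suml; apply: eq_bigr => i _.
rewrite mulr_sumr (bigD1 i) //= big1 ?addr0 ?expr2 // => j ji.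
by apply: pp; rewrite eq_sym.
Qed.

End TwoSupports.

(** * Improved sweep of a single function *)

Section ImprovedSweep.
Variables (N : nat) (w : 'I_N -> 'I_N -> R) (s : seq R).
Hypothesis wG : weighted_graph w.
Hypothesis d_gt0 : forall u, 0 < deg w u.
Hypothesis spec : is_spectrum w s.

Let w_ge0 : forall u v, 0 <= w u v. Proof. by case: wG => _ []. Qed.

(** The factor 2 lost on edges that meet two supports cancels against the 2 from the double counting
    in [dual_energy]. *)
Lemma disjoint_test_functions l (h : 'I_l -> 'I_N -> R) (A B : R) : (0 < l <= N)%nat ->
  (forall u i j, i != j -> h i u * h j u = 0) ->
  (forall i, A <= mass w (h i)) -> (forall i, dual_energy w (h i) <= B) ->
  (2 - s`_(N - l)) * A <= B.
Proof.
move=> lN hh hA hB; have [c [i0 ci0]] := test_functions wG d_gt0 spec h lN.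
have l_lt : (N - l < N)%nat by lia.
have g0 := gap_ge0 wG d_gt0 spec l_lt.
have dis u i j : i != j -> (c i * h i u) * (c j * h j u) = 0.
  by move=> /(hh u) e; rewrite mulrACA e mulr0.
pose S := \sum_i c i ^+ 2.
have S0 : 0 < S.
  rewrite /S (bigD1 i0) //= ltr_pwDl ?exprn_even_gt0 //.
  by apply: sumr_ge0 => i _; exact: sqr_ge0.
have -> : mass w (fun u => \sum_i c i * h i u) = \sum_i c i ^+ 2 * mass w (h i).
  rewrite [RHS](eq_bigr (fun i => \sum_u c i ^+ 2 * (deg w u * h i u ^+ 2))); last first.
    by move=> i _; rewrite /mass mulr_sumr.
  rewrite exchange_big; apply: eq_bigr => u _ /=.
  have -> : (\sum_i c i * h i u) ^+ 2 = \sum_i (c i * h i u) ^+ 2 by exact: sqr_sum_disjoint (dis u).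
  rewrite [LHS]mulr_sumr; apply: eq_bigr => i _.
  by rewrite exprMn mulrCA.
have eE : dual_energy w (fun u => \sum_i c i * h i u) <=
    2 * \sum_i c i ^+ 2 * dual_energy w (h i).
  rewrite [leRHS](_ : _ = \sum_u \sum_v w u v *
       (2 * \sum_i (c i * h i u + c i * h i v) ^+ 2)); last first.
    rewrite /dual_energy [RHS](_ : _ = \sum_u \sum_v \sum_i
        2 * (c i ^+ 2 * (w u v * (h i u + h i v) ^+ 2))); last first.
      apply: eq_bigr => u _; apply: eq_bigr => v _; rewrite !mulr_sumr.
      by apply: eq_bigr => i _; ring.
    under [RHS]eq_bigr => u _ do rewrite exchange_big.
    rewrite exchange_big mulr_sumr; apply: eq_bigr => i _ /=.
    rewrite !mulr_sumr; apply: eq_bigr => u _ /=.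
    by rewrite !mulr_sumr.
  apply: ler_sum => u _; apply: ler_sum => v _; apply: ler_wpM2l => //.
  by rewrite -big_split /=; case: (two_supports (dis u) (dis v)).
move=> h1; have := le_trans h1 eE.
have : S * A <= \sum_i c i ^+ 2 * mass w (h i).
  by rewrite /S mulr_suml; apply: ler_sum => i _; rewrite ler_wpM2l ?sqr_ge0.
have : \sum_i c i ^+ 2 * dual_energy w (h i) <= S * B.
  by rewrite /S mulr_suml; apply: ler_sum => i _; rewrite ler_wpM2l ?sqr_ge0.
move=> hX /(ler_wpM2l g0) hY hG; rewrite -(ler_pM2l S0).
move: hX hY hG; set X := \sum_i _ ; set Y := \sum_i _; set G := 2 - _; lra.
Qed.

(** The support clause is what later separates the pairs obtained from different functions. *)
Lemma sweep_cut (H : 'I_N -> R) : (exists u, H u != 0) ->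
  exists V1 V2 : {set 'I_N}, [/\ [disjoint V1 & V2], V1 :|: V2 != set0,
    forall u, u \in V1 :|: V2 -> H u != 0 &
    (1 - phibar w V1 V2) * (2 * mass1 w H) <= dual_var w H].
Proof.
move=> Hn; have [t [t0 tu ht]] := dual_coarea d_gt0 Hn.
have [dis ne e] := phibar_level wG d_gt0 t0 tu.
exists [set u | t < H u], [set u | H u < - t]; split=> //.
  by move=> u; rewrite !inE => /orP[]; apply: contraTneq => ->; rewrite -leNgt ?oppr_le0.
rewrite -e in ht.
have M0 : 0 < mass1 w (fun u => level_sign t (H u)).
  case: tu => u tu; apply: (mass1_gt0 d_gt0 (u := u)).
  by have [[_ ->]|[_ ->]|[h _]] := level_sign_case (H u) t0;
     rewrite ?oppr_eq0 ?oner_eq0 //; rewrite leNgt tu in h.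
rewrite -(ler_pM2r M0); apply: le_trans ht.
by rewrite le_eqVlt; apply/orP; left; apply/eqP; ring.
Qed.

(* The bands found by [thresholds_or_bands] would be too many disjoint test
   functions of small Rayleigh quotient. *)
Lemma few_thresholds l (f : 'I_N -> R) : (0 < l <= N)%nat ->
  0 < 2 - s`_(N - l) -> 0 < dual_energy w f ->
  exists T, [/\ path <=%R 0 T, (size T <= 4 * l)%nat &
    (2 - s`_(N - l)) * \sum_u deg w u * thr_dist `|f u| 0 T ^+ 2 <= 8 * dual_energy w f].
Proof.
move=> lN; set G := 2 - _; set E := dual_energy w f => G0 E0.
have l0 : 0 < l%:R :> R by rewrite ltr0n; case/andP: lN.
(* Twice what [disjoint_test_functions] allows for l bands of energy at most 2E / l; the 2l rounds
   then cost 2l * C = 8E / G. *)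
pose C := 4 * E / (l%:R * G).
have C0 : 0 < C by rewrite divr_gt0 ?mulr_gt0.
have [] := @thresholds_or_bands R 'I_N (deg w) (fun u => `|f u|) C
  (fun u => ltW (d_gt0 u)) C0 (2 * l)%nat 0.
  move=> [T [pT sT eT]]; exists T; split=> //; first by rewrite (leq_trans sT) // mulnA.
  move: eT; rewrite (eq_bigl xpredT); last by move=> u; rewrite normr_ge0.
  move=> /(ler_wpM2l (ltW G0)); congr (_ <= _).
  by rewrite /C natrM; field; rewrite gt_eqF //= gt_eqF.
move=> [B [sB pB bB CB]].
have Bi (i : 'I_(2 * l)) : nth (0, 0) B i \in B by rewrite mem_nth // sB.
pose lo (i : 'I_(2 * l)) := (nth (0, 0) B i).1.
pose hi (i : 'I_(2 * l)) := (nth (0, 0) B i).2.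
have lo0 i : 0 <= lo i by have /andP[] := bB _ (Bi i).
have tdis x (i j : 'I_(2 * l)) : i != j -> odd_tent (lo i) (hi i) x * odd_tent (lo j) (hi j) x = 0.
  have half (i' j' : 'I_(2 * l)) : (i' < j')%nat ->
      odd_tent (lo i') (hi i') x * odd_tent (lo j') (hi j') x = 0.
    move=> ij; apply/eqP; rewrite mulf_eq0 -[X in X || _]sqrf_eq0 -[X in _ || X]sqrf_eq0.
    rewrite !odd_tent_sqr // !sqrf_eq0.
    have hl : hi i' <= lo j'.
      by move/(pairwiseP (0, 0)): pB; apply; rewrite ?inE ?sB.
    have [//|n1] := eqVneq (tent (lo i') (hi i') `|x|) 0.
    have [//|n2] := eqVneq (tent (lo j') (hi j') `|x|) 0.
    have : 0 < tent (lo i') (hi i') `|x| by rewrite lt_def n1 tent_ge0.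
    have : 0 < tent (lo j') (hi j') `|x| by rewrite lt_def n2 tent_ge0.
    by move=> /tent_gt0 /andP[? ?] /tent_gt0 /andP[? ?]; lra.
  rewrite -val_eqE neq_ltn => /orP[/half //|/half]; by rewrite mulrC.
pose F (i : 'I_(2 * l)) u := odd_tent (lo i) (hi i) (f u).
have FE : \sum_i dual_energy w (F i) <= 2 * E.
  rewrite exchange_big mulr_sumr; apply: ler_sum => u _ /=.
  rewrite exchange_big mulr_sumr; apply: ler_sum => v _ /=.
  rewrite -mulr_sumr mulrCA; apply: ler_wpM2l => //.
  have [_] := two_supports (tdis (f u)) (tdis (f v)); apply; first exact: sqr_ge0.
  move=> i; rewrite -[odd_tent _ _ (f v)]opprK -odd_tentN.
  rewrite -[X in X <= _]real_normK ?num_real // -[X in _ <= X]real_normK ?num_real //.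
  rewrite ler_sqr ?nnegrE //; apply: le_trans (odd_tent_lip _ _ _ (lo0 i)) _.
  by rewrite opprK.
(* Markov's inequality is the reason for asking for 2l bands: the total energy is at most 2E, so at
   most l bands exceed 2E / l and at least l remain. *)
pose Good := [set i | l%:R * dual_energy w (F i) <= 2 * E].
have card : (l <= #|Good|)%nat.
  rewrite leqNgt; apply/negP => Gl.
  have cC : (l.+1 <= #|~: Good|)%nat by have := cardsC Good; rewrite card_ord; lia.
  have : \sum_(i in ~: Good) 2 * E <= l%:R * (2 * E).
    apply: le_trans (ler_wpM2l (ltW l0) FE); rewrite [leRHS]mulr_sumr.
    rewrite [leRHS](bigID (fun i => i \in ~: Good)) /= -[leLHS]addr0; apply: lerD.
      by apply: ler_sum => i; rewrite !inE -ltNge => /ltW.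
    by apply: sumr_ge0 => i _; rewrite mulr_ge0 ?dual_energy_ge0 // ltW.
  rewrite sumr_const -[leLHS]mulr_natl ler_pM2r ?mulr_gt0 // ler_nat; lia.
pose g (i : 'I_l) := enum_val (widen_ord card i).
have gG i : l%:R * dual_energy w (F (g i)) <= 2 * E.
  by have := enum_valP (widen_ord card i); rewrite inE.
have gi i j : i != j -> g i != g j.
  by apply: contraNneq => /enum_val_inj /(congr1 val) /= e; apply/eqP/val_inj.
have : G * C <= 2 * E / l%:R.
  apply: (@disjoint_test_functions l (fun i => F (g i)) C _ lN).
  - by move=> u i j /gi ij; exact: tdis.
  - move=> i; apply: le_trans (CB _ (Bi (g i))) _; rewrite le_eqVlt; apply/orP; left; apply/eqP.
    by apply: eq_bigr => u _; rewrite odd_tent_sqr.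
  - by move=> i; rewrite ler_pdivlMr // mulrC.
have -> : G * C = 4 * E / l%:R by rewrite /C; field; rewrite !gt_eqF.
by rewrite ler_pM2r ?invr_gt0 //; lra.
Qed.

Definition signed_pot (T : seq R) x := Num.sg x * thr_pot `|x| 0 T.

Lemma signed_potN T x : signed_pot T (- x) = - signed_pot T x.
Proof. by rewrite /signed_pot sgrN normrN mulNr. Qed.

Lemma signed_potE T x : path <=%R 0 T -> 0 <= x -> signed_pot T x = thr_pot x 0 T.
Proof.
move=> pT; rewrite le0r /signed_pot => /orP[/eqP ->|x0]; last by rewrite gtr0_sg // mul1r gtr0_norm.
by rewrite sgr0 mul0r (thr_pot_left (lexx 0) pT).
Qed.

(** For opposite signs this is the increment bound of mu between |x| and |y|. For equal signs both
    values are increments from 0, and |x| and |y| are at most |x + y|. *)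
Lemma signed_pot_lip T x y : path <=%R 0 T ->
  `|signed_pot T x + signed_pot T y| <=
  `|x + y| * (thr_dist `|x| 0 T + thr_dist `|y| 0 T + `|x + y|).
Proof.
move=> pT.
have key u v : 0 <= v -> v <= u -> 0 <= thr_pot u 0 T - thr_pot v 0 T <=
    (u - v) * (thr_dist u 0 T + (u - v)).
  by move=> v0 vu; have := thr_pot_incr pT vu; rewrite !(max_idPr _) // (le_trans v0).
have k0 u : 0 <= u -> 0 <= thr_pot u 0 T <= u * (thr_dist u 0 T + u).
  by move=> u0; have := key u 0 (lexx _) u0; rewrite (thr_pot_left (lexx 0) pT) !subr0.
have dd u := thr_dist_ge0 u 0 T.
have same u v : 0 <= u -> 0 <= v -> `|signed_pot T u + signed_pot T v| <=
    `|u + v| * (thr_dist `|u| 0 T + thr_dist `|v| 0 T + `|u + v|).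
  move=> u0 v0; rewrite !signed_potE // (ger0_norm u0) (ger0_norm v0).
  have /andP[a1 a2] := k0 _ u0; have /andP[b1 b2] := k0 _ v0.
  rewrite !ger0_norm ?addr_ge0 //; have := dd u; have := dd v; move: a2 b2; clear -u0 v0.
  by move: (thr_pot u 0 T) (thr_pot v 0 T) (thr_dist u 0 T) (thr_dist v 0 T) => *; nra.
have opp u v : 0 <= v -> v <= u -> `|signed_pot T u - signed_pot T v| <=
    `|u - v| * (thr_dist `|u| 0 T + thr_dist `|v| 0 T + `|u - v|).
  move=> v0 vu; have u0 := le_trans v0 vu; rewrite !signed_potE // (ger0_norm u0) (ger0_norm v0).
  have uv0 : 0 <= u - v by rewrite subr_ge0.
  have /andP[a1 a2] := key _ _ v0 vu; rewrite !ger0_norm //; apply: le_trans a2 _.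
  by apply: ler_wpM2l => //; have := dd v; lra.
have opp' u v : 0 <= u -> 0 <= v -> `|signed_pot T u - signed_pot T v| <=
    `|u - v| * (thr_dist `|u| 0 T + thr_dist `|v| 0 T + `|u - v|).
  move=> u0 v0; have [/(opp _ _ v0)//|/ltW/(opp _ _ u0)] := leP v u.
  by rewrite distrC [`|v - u|]distrC [thr_dist `|v| _ _ + _]addrC.
have [x0|/ltW x0] := leP 0 x; have [y0|/ltW y0] := leP 0 y.
- exact: same.
- by have := opp' x (- y); rewrite oppr_ge0 signed_potN !opprK normrN; apply.
- have := opp' y (- x); rewrite oppr_ge0 signed_potN !opprK normrN.
  by rewrite [y + x]addrC [signed_pot T y + _]addrC [thr_dist `|y| _ _ + _]addrC; apply.
- have := same (- x) (- y); rewrite !oppr_ge0 !signed_potN -!opprD !normrN; exact.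
Qed.

(** The last hypothesis covers a vanishing gap, where the quotient in the conclusion is read as
    0. *)
Lemma improved_sweep l (f : 'I_N -> R) : (0 < l <= N)%nat ->
  (exists u, f u != 0) -> (s`_(N - l) = 2 -> dual_energy w f = 0) ->
  exists V1 V2 : {set 'I_N}, [/\ [disjoint V1 & V2], V1 :|: V2 != set0,
    forall u, u \in V1 :|: V2 -> f u != 0 &
    (1 - phibar w V1 V2) * mass w f <=
      165 * l%:R * (dual_energy w f / Num.sqrt (2 - s`_(N - l)))].
Proof.
move=> lN [u0 fu0] deg0; set E := dual_energy w f; set G := 2 - _.
have l_lt : (N - l < N)%nat by lia.
have G0 : 0 <= G := gap_ge0 wG d_gt0 spec l_lt.
have G2 : G <= 2 := gap_le2 wG d_gt0 spec l_lt.
have E0 : 0 <= E := dual_energy_ge0 wG f.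
have l1 : 1 <= l%:R :> R by rewrite ler1n; case/andP: lN.
have m0 : 0 <= mass w f := mass_ge0 d_gt0 f.
(* Zero energy means f u = - f v along every edge, so sweeping f itself already gives 1 - [phibar]
   <= 0. *)
have [Ez|Ez] := eqVneq E 0.
  have pz u v : w u v * `|f u + f v| = 0.
    move: Ez; rewrite /E /dual_energy => /eqP; rewrite psumr_eq0; last first.
      by move=> i _; apply: sumr_ge0 => j _; rewrite mulr_ge0 ?sqr_ge0.
    move=> /allP /(_ u); rewrite mem_index_enum => /(_ isT) /=.
    rewrite psumr_eq0; last by move=> j _; rewrite mulr_ge0 ?sqr_ge0.
    move=> /allP /(_ v); rewrite mem_index_enum => /(_ isT) /=.
    by rewrite mulf_eq0 sqrf_eq0 => /orP[/eqP ->|/eqP ->]; rewrite ?mul0r ?normr0 ?mulr0.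
  have [V1 [V2 [dis ne sup h]]] := sweep_cut (ex_intro _ u0 fu0).
  exists V1, V2; split=> //; rewrite Ez mul0r mulr0; apply: mulr_le0_ge0 => //.
  move: h; rewrite [dual_var _ _]big1; last by move=> u _; rewrite big1.
  by rewrite pmulr_lle0 // mulr_gt0 // (mass1_gt0 d_gt0 fu0).
have Ep : 0 < E by rewrite lt_def Ez.
have Gp : 0 < G.
  by rewrite lt_def G0 andbT subr_eq0 eq_sym; apply: contraNneq Ez => h; rewrite /E deg0.
have [T [pT sT eT]] := few_thresholds lN Gp Ep.
pose H u := signed_pot T (f u).
have absH u : `|H u| = thr_pot `|f u| 0 T.
  have nn : 0 <= thr_pot `|f u| 0 T.
    apply: le_trans (thr_pot_ge (normr_ge0 _) pT).
    by apply: divr_ge0; rewrite ?sqr_ge0 // mulr_ge0 // ler0n.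
  rewrite /H /signed_pot normrM (ger0_norm nn) normr_sg; have [->|_] := eqVneq (f u) 0.
    by rewrite normr0 (thr_pot_left (lexx 0) pT) mulr0.
  by rewrite mul1r.
pose K := 6 * ((size T).+1%:R : R).
have K0 : 0 < K by rewrite mulr_gt0 // ltr0n.
have HK u : f u ^+ 2 <= K * `|H u|.
  rewrite absH -ler_pdivrMl // mulrC -[f u ^+ 2]real_normK ?num_real //.
  by have := thr_pot_ge (normr_ge0 (f u)) pT; rewrite subr0.
have mH : mass w f <= K * mass1 w H.
  rewrite /mass1 mulr_sumr; apply: ler_sum => u _.
  by rewrite [leRHS]mulrCA; apply: ler_wpM2l => //; exact: ltW.
have Hn : exists u, H u != 0.
  exists u0; rewrite -normr_eq0; apply: contraNneq fu0 => h.
  by have := HK u0; rewrite h mulr0 -sqrf_eq0 => h'; apply/eqP/le_anti; rewrite h' sqr_ge0.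
have Hf u : H u != 0 -> f u != 0.
  by apply: contraNneq => h; rewrite /H h /signed_pot sgr0 mul0r.
have [V1 [V2 [dis ne sup hcut]]] := sweep_cut Hn.
exists V1, V2; split=> //; first by move=> u /sup /Hf.
set r := Num.sqrt G; have r0 : 0 < r by rewrite sqrtr_gt0.
have rr : r ^+ 2 = G by rewrite sqr_sqrtr.
have r2 : r <= 2 by rewrite leNgt; apply/negP => h; nra.
pose dl u := thr_dist `|f u| 0 T.
(* The inequality x * y <= x^2 / (2r) + r * y^2 / 2 with r the root of G gives (1 + 1/r) * E + r *
   (8E / G), that is (r + 9) * E / r, and r <= 2. *)
have varH : dual_var w H <= 11 * E / r.
  have h1 : dual_var w H <= \sum_u \sum_v w u v * (`|f u + f v| * (dl u + dl v + `|f u + f v|)).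
    apply: ler_sum => u _; apply: ler_sum => v _; apply: ler_wpM2l => //.
    exact: signed_pot_lip.
  have h2 u v : w u v * (`|f u + f v| * (dl u + dl v + `|f u + f v|)) <=
     w u v * ((1 + 1 / r) * (f u + f v) ^+ 2) + w u v * (r / 2 * dl u ^+ 2) +
       w u v * (r / 2 * dl v ^+ 2).
    rewrite -!mulrDr; apply: ler_wpM2l => //.
    rewrite -[(f u + f v) ^+ 2]real_normK ?num_real //; move: (`|f u + f v|) (dl u) (dl v) => p a b.
    have amgm x y : x * y <= x ^+ 2 / (2 * r) + r / 2 * y ^+ 2.
      rewrite -subr_ge0 (_ : _ - _ = (x - r * y) ^+ 2 / (2 * r)).
        by rewrite divr_ge0 ?sqr_ge0 ?mulr_ge0 // ltW.
      by field; rewrite gt_eqF.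
    have := amgm p a; have := amgm p b.
    have -> : p ^+ 2 / (2 * r) = (1 / r * p ^+ 2) / 2 by field; rewrite gt_eqF.
    lra.
  have h3 : \sum_u \sum_v w u v * (`|f u + f v| * (dl u + dl v + `|f u + f v|)) <=
     (1 + 1 / r) * E + r * \sum_u deg w u * dl u ^+ 2.
    have e1 : (1 + 1 / r) * E = \sum_u \sum_v w u v * ((1 + 1 / r) * (f u + f v) ^+ 2).
      rewrite /E /dual_energy mulr_sumr; apply: eq_bigr => u _; rewrite mulr_sumr.
      by apply: eq_bigr => v _; rewrite mulrCA.
    have e2 : r / 2 * \sum_u deg w u * dl u ^+ 2 = \sum_u deg w u * (r / 2 * dl u ^+ 2).
      by rewrite mulr_sumr; apply: eq_bigr => u _; rewrite mulrCA.
    have -> : (1 + 1 / r) * E + r * \sum_u deg w u * dl u ^+ 2 =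
      \sum_u \sum_v (w u v * ((1 + 1 / r) * (f u + f v) ^+ 2) + w u v * (r / 2 * dl u ^+ 2) +
       w u v * (r / 2 * dl v ^+ 2)).
      under [RHS]eq_bigr => u _ do rewrite !big_split /=.
      rewrite !big_split /= (sum_deg w) (sum_deg_sym wG) -e1 -e2.
      by move: (\sum_u _) => S; field; rewrite gt_eqF.
    by apply: ler_sum => u _; apply: ler_sum => v _.
  apply: le_trans h1 (le_trans h3 _).
  rewrite ler_pdivlMr // mulrDl.
  have -> : (1 + 1 / r) * E * r = (r + 1) * E by field; rewrite gt_eqF.
  rewrite [r * _]mulrC -mulrA -expr2 rr mulrC.
  have := ler_wpM2r E0 r2; move: eT; rewrite -/E -/G /dl; set S := \sum_u _; lra.
have [phi|phi] := leP (1 - phibar w V1 V2) 0.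
  apply: le_trans (mulr_le0_ge0 phi m0) _.
  by rewrite !mulr_ge0 ?invr_ge0 // ltW.
move: phi hcut; set phi := 1 - _ => phi0 hcut.
(* From 6 * (4l + 1) <= 30l. The final 165 is 30 * 11 / 2, the 2 being the one in [sweep_cut]. *)
have K30 : K <= 30 * l%:R.
  have : (size T).+1%:R <= (4 * l).+1%:R :> R by rewrite ler_nat.
  rewrite /K [X in _ <= X]mulrS natrM; lra.
have h1 := ler_wpM2l (ltW phi0) mH.
have h2 : K * (phi * (2 * mass1 w H)) <= 30 * l%:R * (11 * E / r).
  by apply: ler_pM; rewrite ?mulr_ge0 ?mass1_ge0 ?(ltW K0) ?(ltW phi0) // (le_trans hcut).
move: h1 h2; rewrite -/E; lra.
Qed.

End ImprovedSweep.

(** * Shifted cuts of the half-line *)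

Section Grid.
Variables (R : archiRealFieldType) (m : nat).
Hypothesis m_gt0 : (0 < m)%nat.
Implicit Types (X Y : R) (t : nat).

(* The nonnegative half-line is cut at the integers congruent to [- t] mod [m];
   [cell t X] numbers the resulting intervals and [ramp t X] is the distance
   from [X] to the cuts, truncated at 1. *)
Definition cell t X : nat := (Num.truncn X + t) %/ m.
Definition offset t X : R := X + t%:R - m%:R * (cell t X)%:R.
Definition ramp t X : R := Num.min 1 (Num.min (offset t X) (m%:R - offset t X)).

(* Squared distance between [X] and [Y] after each cell has been folded, by
   [ramp], onto its own ray issued from a common origin. *)
Definition fold_dist t X Y : R :=
  if cell t X == cell t Y then (ramp t X - ramp t Y) ^+ 2
  else (ramp t X + ramp t Y) ^+ 2.

Definition near_cut t X : bool := ramp t X < 1.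

Lemma truncn_bounds X : 0 <= X -> (Num.truncn X)%:R <= X < (Num.truncn X)%:R + 1.
Proof. by move=> X0; have := truncn_itv X0; rewrite -natr1. Qed.

Lemma offsetE t X : offset t X = X - (Num.truncn X)%:R + ((Num.truncn X + t) %% m)%:R.
Proof.
have := divn_eq (Num.truncn X + t) m; rewrite -/(cell t X) => /(congr1 (fun n => n%:R : R)).
by rewrite /offset !natrD natrM; lra.
Qed.

Lemma offset_bounds t X : 0 <= X -> 0 <= offset t X < m%:R.
Proof.
move=> /truncn_bounds /andP[h1 h2]; rewrite offsetE.
have : ((Num.truncn X + t) %% m).+1%:R <= m%:R :> R by rewrite ler_nat ltn_mod.
have : 0 <= ((Num.truncn X + t) %% m)%:R :> R by rewrite ler0n.
by rewrite -natr1 => *; apply/andP; split; lra.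
Qed.

Lemma ramp_bounds t X : 0 <= X -> 0 <= ramp t X <= 1.
Proof.
move=> /(offset_bounds t) /andP[h1 h2]; rewrite /ramp ge_min lexx andbT.
by rewrite !le_min ler01 h1 subr_ge0 ltW.
Qed.

Lemma ramp_same t X Y : cell t X = cell t Y -> `|ramp t X - ramp t Y| <= `|X - Y|.
Proof.
move=> e; have : offset t X - offset t Y = X - Y by rewrite /offset e; lra.
rewrite /ramp; move: (offset t X) (offset t Y) => x y.
rewrite ler_norml; have := ler_norm (X - Y); have := lerNnormlW (lexx `|X - Y|).
by do 2!(match goal with |- context [Num.min ?u (?v - ?u)] => case: (lerP u (v - u)) => ? end);
  do 2!(match goal with |- context [Num.min ?u ?v] => case: (lerP u v) => ? end);
  move=> *; apply/andP; split; lra.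
Qed.

Lemma ramp_diff t X Y : 0 <= X -> 0 <= Y -> cell t X <> cell t Y ->
  ramp t X + ramp t Y <= `|X - Y|.
Proof.
have half X' Y' : 0 <= X' -> 0 <= Y' -> (cell t X' < cell t Y')%nat ->
    ramp t X' + ramp t Y' <= `|X' - Y'|.
  move=> X0 Y0 c.
  have h1 : ramp t X' <= m%:R - offset t X' by rewrite /ramp !ge_min lexx !orbT.
  have h2 : ramp t Y' <= offset t Y' by rewrite /ramp !ge_min lexx !orbT.
  have : m%:R * (cell t X').+1%:R <= m%:R * (cell t Y')%:R :> R by rewrite ler_wpM2l ?ler_nat.
  rewrite distrC; have := ler_norm (Y' - X'); move: h1 h2.
  by rewrite /offset -natr1; lra.
move=> X0 Y0 /eqP; rewrite neq_ltn => /orP[|] c; first exact: half.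
by rewrite addrC distrC half.
Qed.

Lemma sum_shift_eq (n c : nat) : (\sum_(t < m) ((n + t) %% m == c) <= 1)%nat.
Proof.
have [t0 /eqP e0|none] := pickP (fun t : 'I_m => (n + t) %% m == c)%nat; last first.
  by rewrite big1 // => t _; rewrite none.
rewrite (bigD1 t0) //= big1 ?addn0 ?leq_b1 // => t tt0; apply/eqP; rewrite eqb0.
apply: contraNneq tt0 => e; rewrite -val_eqE /=.
have : (n + t == n + t0 %[mod m])%nat by rewrite e e0.
by rewrite eqn_modDl !modn_small.
Qed.

(** A point at distance less than 1 from a cut lies in one of the two unit intervals next to it;
    these have residues 0 and m - 1. *)
Lemma ramp_lt1 t X : 0 <= X -> ramp t X < 1 ->
  ((Num.truncn X + t) %% m == 0)%nat || ((Num.truncn X + t) %% m == m.-1)%nat.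
Proof.
move=> X0; have /andP[h1 h2] := truncn_bounds X0.
rewrite /ramp !gt_min ltxx /= offsetE; set r := (_ %% m)%nat.
have rm : (r < m)%nat by rewrite ltn_mod.
have [//|r0] := eqVneq r 0%nat; have [//|rm1] := eqVneq r m.-1.
have : 1 <= r%:R :> R by rewrite ler1n lt0n.
have : r.+1%:R + 1 <= m%:R :> R by rewrite natr1 ler_nat; lia.
by rewrite -natr1 => ? ? /orP[|]; lra.
Qed.

Lemma sum_near_cut X : 0 <= X -> \sum_(t < m) (near_cut t X)%:R <= 2 :> R.
Proof.
move=> X0; rewrite -natr_sum ler_nat.
apply: leq_trans (leq_add (sum_shift_eq (Num.truncn X) 0) (sum_shift_eq (Num.truncn X) m.-1)).
rewrite -big_split; apply: leq_sum => t _ /=; have := @ramp_lt1 t X X0.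
by rewrite /near_cut; case: (ramp t X < 1) => // /(_ isT); case: eqP; case: eqP.
Qed.

(** Hermite's identity for the floor function. *)
Lemma sum_cell (n : nat) : (\sum_(t < m) ((n + t) %/ m) = n)%nat.
Proof.
elim: n => [|n IH].
  by rewrite big1 // => t _; rewrite add0n divn_small.
case: m m_gt0 IH => // m' _ IH.
rewrite -[in RHS]IH big_ord_recr /= big_ord_recl /= addn0.
have -> : (n.+1 + m' = n + m'.+1)%nat by lia.
rewrite divnDr // divnn /= addn1 -addSn [RHS]addSn addnC -addSn.
congr (_.+1 + _)%nat.
by apply: eq_bigr => i _ /=; rewrite /bump /= addSnnS.
Qed.

(** By [sum_cell] the cell numbers of X and Y differ in total by the difference of the integer
    parts, and every separating shift accounts for at least 1. *)
Lemma sum_cell_neq X Y : 0 <= X -> 0 <= Y ->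
  \sum_(t < m) (cell t X != cell t Y)%:R <= `|X - Y| + 1.
Proof.
have half X' Y' : 0 <= X' -> 0 <= Y' -> X' <= Y' ->
    \sum_(t < m) (cell t X' != cell t Y')%:R <= `|X' - Y'| + 1.
  move=> X0 Y0 XY.
  have tXY : (Num.truncn X' <= Num.truncn Y')%nat by exact: le_truncn.
  have ct t : (cell t X' <= cell t Y')%nat by rewrite leq_div2r // leq_add2r.
  rewrite -natr_sum; apply: (@le_trans _ _ (Num.truncn Y' - Num.truncn X')%:R).
    rewrite ler_nat -{1}(sum_cell (Num.truncn Y')) -{1}(sum_cell (Num.truncn X')) -sumnB //.
      by apply: leq_sum => t _; have := ct t; rewrite /cell; case: eqP => //=; lia.
    by move=> t _; exact: ct.
  rewrite natrB // distrC ger0_norm ?subr_ge0 //.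
  by have /andP[] := truncn_bounds X0; have /andP[] := truncn_bounds Y0; lra.
move=> X0 Y0; have [|/ltW] := leP X Y; first exact: half.
by rewrite distrC; under eq_bigr => t _ do rewrite eq_sym; exact: half.
Qed.

Lemma same_cell_dist t X Y : 0 <= X -> 0 <= Y -> cell t X = cell t Y ->
  (X - Y) ^+ 2 <= m%:R ^+ 2.
Proof.
move=> X0 Y0 e; have : offset t X - offset t Y = X - Y by rewrite /offset e; lra.
have /andP[? ?] := offset_bounds t X0; have /andP[? ?] := offset_bounds t Y0.
move=> <-; rewrite -[leLHS]real_normK ?num_real // ler_sqr ?nnegrE ?ler0n //.
by rewrite ler_norml; apply/andP; split; lra.
Qed.

Lemma fold_dist_ge t X Y : 0 <= X -> 0 <= Y -> (ramp t X - ramp t Y) ^+ 2 <= fold_dist t X Y.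
Proof.
move=> /(ramp_bounds t) /andP[? _] /(ramp_bounds t) /andP[? _]; rewrite /fold_dist.
by case: ifP => // _; nra.
Qed.

Lemma fold_dist_ge0 t X Y : 0 <= fold_dist t X Y.
Proof. by rewrite /fold_dist; case: ifP => _; exact: sqr_ge0. Qed.

Lemma fold_dist_le t X Y : 0 <= X -> 0 <= Y -> fold_dist t X Y <= (X - Y) ^+ 2.
Proof.
move=> X0 Y0; rewrite /fold_dist -[leRHS]real_normK ?num_real //.
have [e|e] := eqVneq (cell t X) (cell t Y).
  by rewrite -[leLHS]real_normK ?num_real // ler_sqr ?nnegrE // ramp_same.
rewrite ler_sqr ?nnegrE //; first by apply: ramp_diff => //; exact/eqP.
by rewrite addr_ge0 //; [case/andP: (ramp_bounds t X0)|case/andP: (ramp_bounds t Y0)].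
Qed.

(** At most 4 shifts put X or Y near a cut, each costing at most D^2. Away from the cuts both ramps
    equal 1, so only a separating shift costs anything, namely 4; then D >= 2, at most D + 1 shifts
    separate, and 4 * (D + 1) <= 3 * D^2. Hence 7 = 4 + 3. *)
Lemma sum_fold_dist X Y : 0 <= X -> 0 <= Y ->
  \sum_(t < m) fold_dist t X Y <= 7 * (X - Y) ^+ 2.
Proof.
move=> X0 Y0; set D := `|X - Y|.
have DD : (X - Y) ^+ 2 = D ^+ 2 by rewrite /D real_normK ?num_real.
have D0 : 0 <= D by rewrite normr_ge0.
pose a t := (near_cut t X)%:R : R; pose b t := (near_cut t Y)%:R : R.
pose c t := (cell t X != cell t Y)%:R : R.
pose far := 2 <= D.
have pt t : fold_dist t X Y <= D ^+ 2 * (a t + b t) + far%:R * 4 * c t.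
  have h1 := fold_dist_le t X0 Y0; rewrite DD in h1.
  have c0 : 0 <= far%:R * 4 * c t by rewrite !mulr_ge0.
  have D2 := sqr_ge0 D.
  rewrite /a /b /near_cut; case: (ltP (ramp t X) 1) => rX; first by case: (ramp t Y < 1); rewrite ?mulr1n ?mulr0n; nra.
  case: (ltP (ramp t Y) 1) => rY; first by rewrite ?mulr1n ?mulr0n; nra.
  rewrite addr0 mulr0 add0r.
  have /andP[_ rX1] := ramp_bounds t X0; have /andP[_ rY1] := ramp_bounds t Y0.
  have eX : ramp t X = 1 by lra. have eY : ramp t Y = 1 by lra.
  rewrite /fold_dist /c eX eY; case: eqP => e; first by rewrite subrr expr0n /= !mulr0.
  have -> /= : far by rewrite /far; have := ramp_diff X0 Y0 e; rewrite eX eY -/D; lra.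
  lra.
apply: (@le_trans _ _ (\sum_(t < m) (D ^+ 2 * (a t + b t) + far%:R * 4 * c t))).
  by apply: ler_sum => t _; exact: pt.
rewrite big_split /= -mulr_sumr -mulr_sumr big_split /=.
have h1 := sum_near_cut X0; have h2 := sum_near_cut Y0; have h3 := sum_cell_neq X0 Y0.
rewrite -/a -/b -/c -/D in h1 h2 h3; rewrite DD.
have k1 : D ^+ 2 * (\sum_(t < m) a t + \sum_(t < m) b t) <= D ^+ 2 * 4.
  by apply: ler_wpM2l; rewrite ?sqr_ge0 // /a /b; lra.
have k2 : far%:R * 4 * \sum_(t < m) c t <= 3 * D ^+ 2.
  rewrite /far; case: (lerP 2 D) => D2; last by rewrite !mul0r mulr_ge0 ?sqr_ge0.
  rewrite mulr1n mul1r; move: h3; set S := \sum_(t < m) _ => h3.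
  have : 0 <= (3 * D + 2) * (D - 2) by rewrite mulr_ge0 //; lra.
  lra.
lra.
Qed.

End Grid.

(** * Disjointly supported functions *)

Section Averages.
Variable R : realFieldType.

Lemma exists_le_average (T : finType) (F : T -> R) (x : T) :
  exists t, #|T|%:R * F t <= \sum_i F i.
Proof.
have [t _ tmin] := @arg_minP _ _ T x xpredT F isT.
exists t; rewrite mulr_natl -sumr_const; apply: ler_sum => i _; exact: tmin.
Qed.

(** Average M / A + E / B, whose sum is at most 2. A vanishing A or B is treated apart because of
    the divisions. *)
Lemma exists_joint_average (T : finType) (M E : T -> R) (A B : R) (x : T) :
  (forall t, 0 <= M t) -> (forall t, 0 <= E t) ->
  \sum_t M t <= A -> \sum_t E t <= B ->
  exists t, #|T|%:R * M t <= 2 * A /\ #|T|%:R * E t <= 2 * B.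
Proof.
move=> M0 E0 hA hB.
have T0 : 0 < #|T|%:R :> R by rewrite ltr0n; apply/card_gt0P; exists x.
have A0 : 0 <= A by apply: le_trans hA; exact: sumr_ge0.
have B0 : 0 <= B by apply: le_trans hB; exact: sumr_ge0.
have [Az|Az] := eqVneq A 0.
  have [t ht] := exists_le_average E x; exists t; split; last by lra.
  have h : M t <= \sum_t M t by rewrite (bigD1 t) //= lerDl sumr_ge0.
  have Mz : M t = 0 by have := M0 t; lra.
  by rewrite Mz; lra.
have [Bz|Bz] := eqVneq B 0.
  have [t ht] := exists_le_average M x; exists t; split; first by lra.
  have h : E t <= \sum_t E t by rewrite (bigD1 t) //= lerDl sumr_ge0.
  have Ez : E t = 0 by have := E0 t; lra.
  by rewrite Ez; lra.
have Ap : 0 < A by rewrite lt_def Az. have Bp : 0 < B by rewrite lt_def Bz.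
have [t ht] := exists_le_average (fun t => M t / A + E t / B) x; exists t.
have hs : \sum_t (M t / A + E t / B) <= 2.
  rewrite big_split /= -!mulr_suml.
  have : (\sum_t M t) / A <= 1 by rewrite ler_pdivrMr // mul1r.
  have : (\sum_t E t) / B <= 1 by rewrite ler_pdivrMr // mul1r.
  by lra.
have a0 : 0 <= #|T|%:R * (M t / A) by rewrite mulr_ge0 ?divr_ge0.
have b0 : 0 <= #|T|%:R * (E t / B) by rewrite mulr_ge0 ?divr_ge0.
by split; rewrite -ler_pdivrMr // -mulrA; lra.
Qed.

(* Pieces of mass at most [M] are merged greedily: a minimal set of pieces of
   mass at least 1/2 is either a single piece or has mass less than 1. *)
Lemma heavy_groups (T : finType) (m : T -> R) (M : R) : 1 <= M ->
  (forall i, 0 <= m i <= M) -> forall n (A : {set T}),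
  n%:R * M + 1 / 2 <= \sum_(i in A) m i ->
  exists G : nat -> {set T}, [/\ forall i, G i \subset A,
    forall i j, (i <= n)%nat -> (j <= n)%nat -> i != j -> [disjoint G i & G j] &
    forall i, (i <= n)%nat -> 1 / 2 <= \sum_(x in G i) m x].
Proof.
move=> M1 mM; elim=> [|n IH] A hA.
  exists (fun=> A); split=> // [i j|i].
    by rewrite !leqn0 => /eqP -> /eqP ->.
  by move=> _; move: hA; rewrite mul0r add0r.
pose P (B : {set T}) := 1 / 2 <= \sum_(i in B) m i.
have PA : P A by apply: le_trans hA; rewrite lerDr mulr_ge0 //; lra.
have [B /minsetP[PB Bmin] BA] := minset_exists PA.
have BM : \sum_(i in B) m i <= M.
  have [/existsP[x /andP[xB hx]]|] := boolP [exists x, (x \in B) && (1 / 2 <= m x)].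
    have -> : B = [set x].
      apply/esym/Bmin; last by rewrite sub1set.
      by rewrite /P big_set1.
    by rewrite big_set1; case/andP: (mM x).
  rewrite negb_exists => /forallP small.
  have [x xB|B0] := pickP (mem B); last by rewrite big_pred0 //; lra.
  rewrite /= in xB; have mx : m x < 1 / 2 by have := small x; rewrite xB -ltNge.
  have : ~~ P (B :\ x).
    apply/negP => /Bmin /(_ (subsetDl _ _)) e; have := xB; rewrite -e.
    by rewrite !inE eqxx.
  rewrite /P -ltNge => h; rewrite (big_setD1 x) //=; lra.
(* Removing [B] costs at most [M], so n * M + 1/2 remains for the other groups. *)
have [|G [GA Gd Gm]] := IH (A :\: B).
  move: hA; rewrite (big_setID B) /= (setIidPr BA) mulrS; lra.
exists (fun i => if i is i'.+1 then G i' else B); split.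
- by case=> [|i] //; apply: subset_trans (GA i) (subsetDl _ _).
- have BG i : [disjoint B & G i].
    rewrite disjoint_sym; apply: disjointWl (GA i) _.
    by rewrite -setI_eq0 setIDAC setDIl setDv setI0.
  case=> [|i] [|j] //; rewrite ?ltnS.
  + by move=> *; rewrite disjoint_sym; exact: BG.
  + by move=> hi hj ij; exact: Gd.
- by case=> [|i] //; exact: Gm.
Qed.

End Averages.

(** Product rule: th F + th' F' = th (F + F') - (th - th') F'. Here [a] and [b] tell whether the two
    ends of an edge belong to a given group; if just one does, the cut-off there is itself small, by
    the last hypothesis. *)
Lemma cut_off_pointwise (R : realFieldType) (a b F F' th th' X : R) :
  (a = 0 \/ a = 1) -> (b = 0 \/ b = 1) -> 0 <= th <= 1 ->
  (th - th') ^+ 2 <= X -> (a != b -> th ^+ 2 + th' ^+ 2 <= X) ->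
  (th * F * a + th' * F' * b) ^+ 2 <= 2 * (F + F') ^+ 2 + 2 * X * F' ^+ 2.
Proof.
move=> a01 b01 /andP[t0 t1] hX hab.
have X0 : 0 <= X := le_trans (sqr_ge0 _) hX.
have s1 := sqr_ge0 (F + F'); have s2 := sqr_ge0 F'.
have t2 : th ^+ 2 <= 1 by rewrite exprn_ile1.
have p1 : th ^+ 2 * (F + F') ^+ 2 <= 1 * (F + F') ^+ 2 by apply: ler_wpM2r.
have XF := mulr_ge0 X0 s2.
have q1 := sqr_ge0 th; have q2 := sqr_ge0 th'.
case: a01 => ea; case: b01 => eb; rewrite ea eb ?mulr0 ?mulr1 ?addr0 ?add0r in hab *.
- by rewrite expr0n /=; lra.
- have q : th ^+ 2 + th' ^+ 2 <= X by apply: hab; rewrite eq_sym oner_eq0.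
  have h : th' ^+ 2 * F' ^+ 2 <= X * F' ^+ 2 by apply: ler_wpM2r => //; lra.
  rewrite exprMn; lra.
- have q := hab (oner_neq0 _).
  have h : th ^+ 2 * F' ^+ 2 <= X * F' ^+ 2 by apply: ler_wpM2r => //; lra.
  have h2 : 0 <= th ^+ 2 * (F + 2 * F') ^+ 2 by rewrite mulr_ge0 ?sqr_ge0.
  lra.
- have h : (th - th') ^+ 2 * F' ^+ 2 <= X * F' ^+ 2 by apply: ler_wpM2r.
  have h2 : 0 <= (th * (F + F') + (th - th') * F') ^+ 2 by rewrite sqr_ge0.
  lra.
Qed.

(** * Localizing the spectral embedding *)

Section DisjointFunctions.
Variables (N k : nat) (w : 'I_N -> 'I_N -> R) (f : 'I_k -> 'I_N -> R) (Lam : R).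
Hypothesis wG : weighted_graph w.
Hypothesis d_gt0 : forall u, 0 < deg w u.
Hypothesis k_gt0 : (0 < k)%nat.
Hypothesis ortho : forall i j, \sum_u deg w u * (f i u * f j u) = (i == j)%:R.
Hypothesis f_energy : forall i, dual_energy w (f i) <= Lam.

Let wC : forall u v, w u v = w v u. Proof. by case: wG. Qed.
Let w_ge0 : forall u v, 0 <= w u v. Proof. by case: wG => _ []. Qed.

Let sq u := \sum_j f j u ^+ 2.
(* Radial projection of the spectral embedding (0 at the zeros of the embedding). *)
Let x (j : 'I_k) u := f j u / Num.sqrt (sq u).

Let sq_ge0 u : 0 <= sq u.
Proof. by apply: sumr_ge0 => j _; exact: sqr_ge0. Qed.

Let xE j u : f j u = Num.sqrt (sq u) * x j u.
Proof.
have [s0|s0] := eqVneq (sq u) 0; last by rewrite /x mulrC divfK // gt_eqF // sqrtr_gt0 lt_def s0 sq_ge0.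
rewrite s0 sqrtr0 mul0r; move/eqP: s0; rewrite /sq psumr_eq0 => [|i _]; last exact: sqr_ge0.
by move=> /allP /(_ j); rewrite mem_index_enum => /(_ isT) /=; rewrite sqrf_eq0 => /eqP.
Qed.

Let x_unit u : sq u != 0 -> \sum_j x j u ^+ 2 = 1.
Proof.
move=> s0; rewrite /x; under eq_bigr => j _ do rewrite expr_div_n sqr_sqrtr //.
by rewrite -mulr_suml divff.
Qed.

Let x_zero u j : sq u = 0 -> x j u = 0.
Proof. by rewrite /x => ->; rewrite sqrtr0 invr0 mulr0. Qed.

Let x_bound j u : -1 <= x j u <= 1.
Proof.
have [s0|s0] := eqVneq (sq u) 0; first by rewrite x_zero //; apply/andP; split; lra.
have := x_unit s0; rewrite (bigD1 j) //= => e.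
have : x j u ^+ 2 <= 1.
  by rewrite -e lerDl; apply: sumr_ge0 => i _; exact: sqr_ge0.
move: (x j u) => y h; have h1 : 0 <= (1 + y) ^+ 2 by exact: sqr_ge0.
have h2 : 0 <= (1 - y) ^+ 2 by exact: sqr_ge0.
by apply/andP; split; nra.
Qed.

Let dot u v := \sum_j x j u * x j v.

Let sum_sqrD u v : sq u != 0 -> sq v != 0 -> \sum_j (x j u + x j v) ^+ 2 = 2 + 2 * dot u v.
Proof.
move=> u0 v0; have -> : 2 + 2 * dot u v = \sum_j x j u ^+ 2 + \sum_j x j v ^+ 2 + 2 * dot u v.
  by rewrite !x_unit //; lra.
rewrite /dot mulr_sumr -!big_split; apply: eq_bigr => j _ /=; ring.
Qed.

Let sum_sqrB u v : sq u != 0 -> sq v != 0 -> \sum_j (x j u - x j v) ^+ 2 = 2 - 2 * dot u v.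
Proof.
move=> u0 v0; have -> : 2 - 2 * dot u v = \sum_j x j u ^+ 2 + \sum_j x j v ^+ 2 - 2 * dot u v.
  by rewrite !x_unit //; lra.
rewrite /dot mulr_sumr -big_split -sumrB; apply: eq_bigr => j _ /=; ring.
Qed.

(** Up to the antipodal sign, this says that normalizing vectors multiplies distances by at most 2 /
    |F v|, where F is the embedding and [sq v] is |F v|^2. *)
Lemma radial_projection_lip u v :
  sq v * \sum_j (x j u + x j v) ^+ 2 <= 4 * \sum_j (f j u + f j v) ^+ 2.
Proof.
have [v0|v0] := eqVneq (sq v) 0.
  by rewrite v0 mul0r mulr_ge0 // sumr_ge0 // => j _; exact: sqr_ge0.
have [u0|u0] := eqVneq (sq u) 0.
  have -> : \sum_j (x j u + x j v) ^+ 2 = 1.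
    by rewrite -(x_unit v0); apply: eq_bigr => j _; rewrite x_zero // add0r.
  have -> : \sum_j (f j u + f j v) ^+ 2 = sq v.
    by apply: eq_bigr => j _; rewrite [f j u]xE x_zero // mulr0 add0r.
  have := sq_ge0 v; lra.
have c1 : 0 <= 2 + 2 * dot u v by rewrite -sum_sqrD // sumr_ge0 // => j _; exact: sqr_ge0.
have c2 : 0 <= 2 - 2 * dot u v by rewrite -sum_sqrB // sumr_ge0 // => j _; exact: sqr_ge0.
rewrite sum_sqrD //.
set a := Num.sqrt (sq u); set b := Num.sqrt (sq v).
have -> : \sum_j (f j u + f j v) ^+ 2 = a ^+ 2 + b ^+ 2 + 2 * (a * b) * dot u v.
  have -> : a ^+ 2 + b ^+ 2 = a ^+ 2 * \sum_j x j u ^+ 2 + b ^+ 2 * \sum_j x j v ^+ 2.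
    by rewrite !x_unit // !mulr1.
  rewrite /dot !mulr_sumr -!big_split; apply: eq_bigr => j _ /=.
  by rewrite !xE -/a -/b; ring.
have -> : sq v = b ^+ 2 by rewrite sqr_sqrtr.
have a0 : 0 <= a by exact: sqrtr_ge0. have b0 : 0 <= b by exact: sqrtr_ge0.
move: (dot u v) c1 c2 => c c1 c2; rewrite -subr_ge0.
have -> : 4 * (a ^+ 2 + b ^+ 2 + 2 * (a * b) * c) - b ^+ 2 * (2 + 2 * c) =
  4 * (a + b * c) ^+ 2 + b ^+ 2 * (2 * (1 - 2 * c) * (1 + c)) by ring.
(* Each sign of the cosine c has its own decomposition into nonnegative terms. *)
have [c0|c0] := leP c 0.
  by rewrite addr_ge0 // mulr_ge0 ?sqr_ge0 // mulr_ge0; lra.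
have -> : 4 * (a + b * c) ^+ 2 + b ^+ 2 * (2 * (1 - 2 * c) * (1 + c)) =
  4 * a ^+ 2 + 8 * (a * b * c) + b ^+ 2 * (2 * (1 - c)) by ring.
by rewrite !addr_ge0 // !mulr_ge0 ?sqr_ge0 //; lra.
Qed.

Lemma sum_embedding_sq (a : 'I_k -> R) :
  \sum_u deg w u * (\sum_j a j * f j u) ^+ 2 = \sum_j a j ^+ 2.
Proof.
transitivity (\sum_i \sum_j (a i * a j) * \sum_u deg w u * (f i u * f j u)).
  under [RHS]eq_bigr => i _ do under eq_bigr => j _ do rewrite mulr_sumr.
  under [RHS]eq_bigr => i _ do rewrite exchange_big.
  rewrite exchange_big; apply: eq_bigr => u _.
  rewrite expr2 mulr_suml [LHS]mulr_sumr; apply: eq_bigr => i _.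
  rewrite mulr_sumr [LHS]mulr_sumr; apply: eq_bigr => j _; ring.
apply: eq_bigr => i _; rewrite (bigD1 i) //= ortho eqxx mulr1 big1 ?addr0 ?expr2 //.
by move=> j ji; rewrite ortho eq_sym (negbTE ji) mulr0.
Qed.

Lemma total_mass : \sum_u deg w u * sq u = k%:R.
Proof.
rewrite -[in RHS](card_ord k) -sum1_card natr_sum.
rewrite (eq_bigr (fun u => \sum_j deg w u * f j u ^+ 2)); last by move=> u _; rewrite mulr_sumr.
rewrite exchange_big; apply: eq_bigr => i _.
transitivity ((i == i)%:R : R); last by rewrite eqxx.
by rewrite -ortho; apply: eq_bigr => u _; rewrite expr2.
Qed.

(** By [sum_embedding_sq] the embedding has mass exactly 1 along the unit direction of one point of
    the piece. All other points are nearly collinear with it, so the mass of the piece is at most 1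
    / (1 - 1/(9k)). *)
Lemma piece_mass (A : {pred 'I_N}) : {in A &, forall u v, sq u != 0 -> sq v != 0 ->
     1 - (9 * k%:R)^-1 <= dot u v ^+ 2} ->
  \sum_(u in A) deg w u * sq u <= 1 + (4 * k%:R)^-1.
Proof.
move=> hA.
have k1 : 1 <= k%:R :> R by rewrite ler1n.
have K0 : 0 <= (4 * k%:R)^-1 :> R by rewrite invr_ge0; lra.
have [u /andP[uA u0]|none] := pickP (fun u => (u \in A) && (sq u != 0)); last first.
  rewrite big1 ?addr_ge0 // => u uA; have := none u; rewrite uA /= => /negbFE/eqP ->.
  by rewrite mulr0.
have h : (1 - (9 * k%:R)^-1) * \sum_(v in A) deg w v * sq v <= 1.
  rewrite -[leRHS](x_unit u0) -[leRHS](sum_embedding_sq (fun j => x j u)).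
  rewrite [leRHS](bigID (mem A)) /= -[leLHS]addr0; apply: lerD; last first.
    by apply: sumr_ge0 => v _; rewrite mulr_ge0 ?sqr_ge0 // ltW.
  rewrite mulr_sumr; apply: ler_sum => v vA; rewrite mulrCA; apply: ler_wpM2l; first exact: ltW.
  have -> : \sum_j x j u * f j v = Num.sqrt (sq v) * dot u v.
    by rewrite /dot mulr_sumr; apply: eq_bigr => j _; rewrite xE mulrCA.
  rewrite exprMn sqr_sqrtr // mulrC; have [->|v0] := eqVneq (sq v) 0; first by rewrite !mul0r.
  by apply: ler_wpM2l => //; exact: hA.
have e9 : (9 * k%:R)^-1 = (4 * k%:R)^-1 * (4 / 9) :> R by field; rewrite gt_eqF //; lra.
have K1 : (4 * k%:R)^-1 <= 1 / 4 :> R.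
  by rewrite -[leLHS]mul1r ler_pdivrMr; lra.
move: h; rewrite e9; move: ((4 * k%:R)^-1) K0 K1 (\sum_(v in A) _) => a a0 a1 S h.
nra.
Qed.

(** Lengths are scaled by [S] so that ramps have width 1. A cell then spans m / S = 1/(3k) of a
    coordinate; a point is near a cut for at most 2 of the m shifts; and S^2 / m = 288 k^4 is the
    average price in energy. *)
Let m : nat := (32 * (k * k))%nat.
Let S := 96 * ((k%:R : R) ^+ 3).
(** The boolean selects x_j or - x_j, moved into the nonnegative half-line. Comparing u at [p] with
    v at [flip p] measures x_j u + x_j v, the quantity in the dual energy. *)
Let pos (p : 'I_k * bool) u := S * (1 + (if p.2 then x p.1 u else - x p.1 u)).
Let flip (p : 'I_k * bool) := (p.1, ~~ p.2).

Let m_gt0 : (0 < m)%nat. Proof. by rewrite /m !muln_gt0 k_gt0. Qed.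
Let k_ge1 : 1 <= k%:R :> R. Proof. by rewrite ler1n. Qed.
Let S_gt0 : 0 < S. Proof. by rewrite /S mulr_gt0 // exprn_gt0 // ltr0n. Qed.
Let mE : m%:R = 32 * k%:R ^+ 2 :> R. Proof. by rewrite /m !natrM expr2. Qed.

Let pos_ge0 p u : 0 <= pos p u.
Proof.
rewrite /pos; apply: mulr_ge0; first exact: ltW.
by have /andP[? ?] := x_bound p.1 u; case: ifP => _; lra.
Qed.

Let pos_flip p u v : (pos p u - pos (flip p) v) ^+ 2 = S ^+ 2 * (x p.1 u + x p.1 v) ^+ 2.
Proof. by rewrite /pos /flip /=; case: p => j [] /=; ring. Qed.

Let pos_same p u v : (pos p u - pos p v) ^+ 2 = S ^+ 2 * (x p.1 u - x p.1 v) ^+ 2.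
Proof. by rewrite /pos /=; case: p => j [] /=; ring. Qed.

Let near_mass (j : 'I_k) (t : nat) :=
  \sum_(b : bool) \sum_u deg w u * sq u * (near_cut m t (pos (j, b) u))%:R.
Let fold_energy (j : 'I_k) (t : nat) :=
  \sum_(b : bool) \sum_u \sum_v
    w u v * sq v * fold_dist m t (pos (j, b) u) (pos (j, ~~ b) v).
Let proj_energy (j : 'I_k) := \sum_u \sum_v w u v * sq v * (x j u + x j v) ^+ 2.

(** Over all shifts the near-cut masses add up to at most 4k and the folded energies to at most 14
    S^2 times [proj_energy]. Asking for both bounds at one shift doubles them, and then one divides
    by m. *)
Lemma exists_shifts : exists t : 'I_k -> 'I_m, forall j,
  4 * k%:R * near_mass j (t j) <= 1 /\
  fold_energy j (t j) <= 28 * 288 * k%:R ^+ 4 * proj_energy j.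
Proof.
have K0 : 0 < k%:R :> R by rewrite ltr0n.
have dsq u : 0 <= deg w u * sq u by rewrite mulr_ge0 // ltW.
have wsq u v : 0 <= w u v * sq v by rewrite mulr_ge0.
suff h j : exists t : 'I_m, 4 * k%:R * near_mass j t <= 1 /\
    fold_energy j t <= 28 * 288 * k%:R ^+ 4 * proj_energy j by exact: fin_all_exists h.
have hM : \sum_(t < m) near_mass j t <= 4 * k%:R.
  rewrite exchange_big big_bool /=.
  have half b : \sum_(t < m) \sum_u deg w u * sq u * (near_cut m t (pos (j, b) u))%:R <= 2 * k%:R.
    rewrite -total_mass mulr_sumr exchange_big; apply: ler_sum => u _ /=.
    rewrite -mulr_sumr [leRHS]mulrC; apply: ler_wpM2l => //; exact: sum_near_cut.
  by have := half true; have := half false; lra.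
have hE : \sum_(t < m) fold_energy j t <= 14 * S ^+ 2 * proj_energy j.
  rewrite exchange_big big_bool /=.
  have half b : \sum_(t < m) \sum_u \sum_v
      w u v * sq v * fold_dist m t (pos (j, b) u) (pos (j, ~~ b) v) <= 7 * S ^+ 2 * proj_energy j.
    rewrite /proj_energy mulr_sumr exchange_big; apply: ler_sum => u _ /=.
    rewrite mulr_sumr exchange_big; apply: ler_sum => v _ /=.
    rewrite -mulr_sumr [leRHS]mulrCA; apply: ler_wpM2l => //.
    by rewrite -mulrA -(pos_flip (j, b)); exact: sum_fold_dist.
  by have := half true; have := half false; lra.
have M0 (t : 'I_m) : 0 <= near_mass j t.
  by do 2![apply: sumr_ge0 => ? _]; rewrite mulr_ge0 // ler0n.
have E0 (t : 'I_m) : 0 <= fold_energy j t.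
  by do 3![apply: sumr_ge0 => ? _]; rewrite mulr_ge0 // fold_dist_ge0.
have [t [h1 h2]] := exists_joint_average (Ordinal m_gt0) M0 E0 hM hE.
exists t; rewrite card_ord mE in h1 h2; split.
  by rewrite -(ler_pM2r K0); move: h1; move: (near_mass _ _) => z; nra.
rewrite -(ler_pM2l (_ : 0 < 32 * k%:R ^+ 2)); last by rewrite mulr_gt0 // exprn_gt0.
apply: le_trans h2 _; rewrite /S le_eqVlt; apply/orP; left; apply/eqP; ring.
Qed.

Section Shifted.
Variable t : 'I_k -> 'I_m.

Let theta u := \big[Num.min/1]_(p : 'I_k * bool) ramp m (t p.1) (pos p u).
(** A sum over the axes rather than a maximum, so that its weighted total is exactly the sum of the
    [fold_energy] controlled by the shifts. *)
Let gap u v := \sum_p fold_dist m (t p.1) (pos p u) (pos (flip p) v).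
Let cells u := [:: [ffun j => cell m (t j) (pos (j, true) u)];
                   [ffun j => cell m (t j) (pos (j, false) u)]].
(* Antipodal cells are identified. *)
Let piece u := [set v | perm_eq (cells u) (cells v)].

Let rho_ge0 p u : 0 <= ramp m (t p.1) (pos p u).
Proof. by case/andP: (ramp_bounds m_gt0 (t p.1) (pos_ge0 p u)). Qed.

Lemma theta_le p u : theta u <= ramp m (t p.1) (pos p u).
Proof. exact: bigmin_le. Qed.

Lemma theta_bounds u : 0 <= theta u <= 1.
Proof.
rewrite bigmin_le_id andbT; apply/bigmin_geP; split=> [|p _]; first exact: ler01.
exact: rho_ge0.
Qed.

Lemma theta_attained u : exists p, theta u = ramp m (t p.1) (pos p u).
Proof.
have [|p _ e] := @eq_bigmin _ _ _ 1 (Ordinal k_gt0, true) xpredT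
  (fun p => ramp m (t p.1) (pos p u)) isT; last by exists p; exact: e.
by move=> p _; case/andP: (ramp_bounds m_gt0 (t p.1) (pos_ge0 p u)).
Qed.

Let flipK p : flip (flip p) = p. Proof. by case: p => j []. Qed.

Let gap_ge p u v : fold_dist m (t p.1) (pos p u) (pos (flip p) v) <= gap u v.
Proof. by rewrite /gap (bigD1 p) //= lerDl sumr_ge0 // => q _; exact: fold_dist_ge0. Qed.

(** On the axis where the smaller cut-off is attained, the ramp at the other vertex is at least the
    larger cut-off, so the ramps differ by at least as much. *)
Lemma theta_gap u v : (theta u - theta v) ^+ 2 <= gap u v.
Proof.
have key p : `|theta u - theta v| <= `|ramp m (t p.1) (pos p u) - ramp m (t p.1) (pos (flip p) v)| ->
    (theta u - theta v) ^+ 2 <= gap u v.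
  move=> h; apply: le_trans (gap_ge p u v).
  apply: le_trans (fold_dist_ge m_gt0 (t p.1) (pos_ge0 p u) (pos_ge0 (flip p) v)).
  by rewrite -[leLHS]real_normK ?num_real // -[leRHS]real_normK ?num_real // ler_sqr ?nnegrE.
have [uv|/ltW vu] := leP (theta u) (theta v).
  have [p ep] := theta_attained u; apply: (key p).
  have := theta_le (flip p) v; rewrite -ep /= => h.
  by rewrite distrC [leRHS]distrC !ger0_norm ?subr_ge0 //; lra.
have [p ep] := theta_attained v; apply: (key (flip p)); rewrite flipK /= -ep.
have := theta_le (flip p) u; rewrite /= => h.
by rewrite !ger0_norm ?subr_ge0 //; lra.
Qed.

Lemma piece_neq u v : piece u != piece v ->
  exists p, cell m (t p.1) (pos p u) <> cell m (t p.1) (pos (flip p) v).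
Proof.
move=> uv; have [/existsP[p /eqP hp]|] :=
  boolP [exists p, cell m (t p.1) (pos p u) != cell m (t p.1) (pos (flip p) v)]; first by exists p.
rewrite negb_exists => /forallP all_eq; case/negP: uv; apply/eqP/setP => z; rewrite !inE.
suff e : perm_eq (cells u) (cells v) by rewrite (permPl e).
have e1 : [ffun j => cell m (t j) (pos (j, true) u)] = [ffun j => cell m (t j) (pos (j, false) v)].
  by apply/ffunP => j; rewrite !ffunE; have := all_eq (j, true); rewrite negbK => /eqP.
have e2 : [ffun j => cell m (t j) (pos (j, false) u)] = [ffun j => cell m (t j) (pos (j, true) v)].
  by apply/ffunP => j; rewrite !ffunE; have := all_eq (j, false); rewrite negbK => /eqP.
by rewrite /cells e1 e2 (perm_catC [:: _] [:: _]).
Qed.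

(** Some axis separates u from the antipode of v, and [fold_dist] places different cells on
    different rays, where distances to the origin add. *)
Lemma piece_gap u v : piece u != piece v -> theta u ^+ 2 + theta v ^+ 2 <= gap u v.
Proof.
case/piece_neq => p hp; apply: le_trans (gap_ge p u v).
rewrite /fold_dist; case: eqP => // _.
have := theta_le p u; have := theta_le (flip p) v; rewrite /=.
have /andP[+ _] := theta_bounds u; have /andP[+ _] := theta_bounds v.
by move: (ramp _ _ _) (ramp _ _ _) (theta u) (theta v) => *; nra.
Qed.

Lemma piece_eq u v : piece u = piece v ->
  (forall p, cell m (t p.1) (pos p u) = cell m (t p.1) (pos p v)) \/
  (forall p, cell m (t p.1) (pos p u) = cell m (t p.1) (pos (flip p) v)).
Proof.
move=> /setP /(_ v); rewrite !inE perm_refl /cells => e.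
set a := [ffun j => _] in e; set b := [ffun j => _] in e.
set c := [ffun j => _] in e; set d := [ffun j => _] in e.
have : a \in [:: c; d] by rewrite -(perm_mem e) mem_head.
rewrite !inE => /orP[] /eqP ac; rewrite ac in e.
  left; move: e; rewrite perm_cons => /perm_mem /(_ b); rewrite !inE eqxx => /esym/eqP bd.
  case=> j [] /=.
    by move/ffunP: ac => /(_ j); rewrite !ffunE.
  by move/ffunP: bd => /(_ j); rewrite !ffunE.
right; move: e; rewrite -[X in perm_eq _ X]/([:: c] ++ [:: d]) perm_sym perm_catC /= perm_cons.
move=> /perm_mem /(_ c); rewrite !inE eqxx => /esym/eqP bd.
case=> j [] /=.
  by move/ffunP: ac => /(_ j); rewrite !ffunE.
by move/ffunP: bd => /(_ j); rewrite !ffunE => ->.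
Qed.

(** Each coordinate of x u is within 1/(3k) of that of x v, or each is within 1/(3k) of that of - x
    v. The squared distance is thus at most k / (9k^2), and it equals 2 minus or plus twice the dot
    product. *)
Lemma piece_dot u v : piece u = piece v -> sq u != 0 -> sq v != 0 ->
  1 - (9 * k%:R)^-1 <= dot u v ^+ 2.
Proof.
move=> uv u0 v0.
have K0 : 0 < k%:R :> R by rewrite ltr0n.
have sumle (F : 'I_k -> R) : (forall j, S ^+ 2 * F j <= m%:R ^+ 2) -> \sum_j F j <= (9 * k%:R)^-1.
  move=> hF; apply: (@le_trans _ _ (\sum_(j < k) (9 * k%:R ^+ 2)^-1)).
    apply: ler_sum => j _; have := hF j; rewrite mE /S => h.
    rewrite -[leRHS]mul1r ler_pdivlMr; last by rewrite mulr_gt0 // exprn_gt0.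
    rewrite -(ler_pM2l (_ : 0 < 1024 * k%:R ^+ 4)); last by rewrite mulr_gt0 // exprn_gt0.
    by move: h; move: (F j) => z; lra.
  rewrite sumr_const card_ord -mulr_natl le_eqVlt; apply/orP; left; apply/eqP.
  by field; rewrite gt_eqF.
have k1 : 1 <= k%:R :> R by exact: k_ge1.
have k9 : 0 < (9 * k%:R)^-1 :> R by rewrite invr_gt0 mulr_gt0.
have k9' : (9 * k%:R)^-1 <= 1 :> R by rewrite -[leLHS]mul1r ler_pdivrMr; lra.
have fin (z : R) : 2 - 2 * z <= (9 * k%:R)^-1 -> 1 - (9 * k%:R)^-1 <= z ^+ 2.
  move: ((9 * k%:R)^-1) k9 k9' => e e0 e1 h; have h2 : 0 <= 1 - e / 2 by lra.
  have : (1 - e / 2) ^+ 2 <= z ^+ 2 by rewrite ler_sqr ?nnegrE; lra.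
  by have := sqr_ge0 e; lra.
have [h|h] := piece_eq uv.
  apply: fin; rewrite -sum_sqrB //; apply: sumle => j.
  by rewrite -(pos_same (j, true)); apply: same_cell_dist (h (j, true)).
rewrite -sqrrN; apply: fin; rewrite mulrN opprK -sum_sqrD //; apply: sumle => j.
by rewrite -(pos_flip (j, true)); apply: same_cell_dist (h (j, true)).
Qed.

Hypothesis ht : forall j, 4 * k%:R * near_mass j (t j) <= 1 /\
  fold_energy j (t j) <= 28 * 288 * k%:R ^+ 4 * proj_energy j.

(** The cut-off is 1 unless some axis is near a cut. By the union bound the k axes lose at most
    1/(4k) each. *)
Lemma cut_off_mass : k%:R - 1 / 4 <= \sum_u deg w u * sq u * theta u ^+ 2.
Proof.
have k1 : 1 <= k%:R :> R by exact: k_ge1.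
have lost : \sum_(j < k) near_mass j (t j) <= 1 / 4.
  apply: (@le_trans _ _ (\sum_(j < k) (4 * k%:R)^-1)).
    apply: ler_sum => j _; have [h _] := ht j.
    by rewrite -[leRHS]mul1r ler_pdivlMr; [rewrite mulrC|lra].
  rewrite sumr_const card_ord -mulr_natl le_eqVlt; apply/orP; left; apply/eqP.
  by field; rewrite gt_eqF //; lra.
have e : \sum_(j < k) near_mass j (t j) =
    \sum_u deg w u * sq u * \sum_p (near_cut m (t p.1) (pos p u))%:R.
  rewrite (eq_bigr (fun u => \sum_j \sum_(b : bool)
      deg w u * sq u * (near_cut m (t j) (pos (j, b) u))%:R)); last first.
    move=> u _; rewrite [LHS]mulr_sumr pair_bigA; apply: eq_bigr => -[j b] _ //.
  by rewrite [RHS]exchange_big; apply: eq_bigr => j _; exact: exchange_big.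
have : \sum_u deg w u * sq u * (1 - \sum_p (near_cut m (t p.1) (pos p u))%:R) <=
   \sum_u deg w u * sq u * theta u ^+ 2.
  apply: ler_sum => u _; apply: ler_wpM2l; first by rewrite mulr_ge0 // ltW.
  have [/existsP[p hp]|] := boolP [exists p, near_cut m (t p.1) (pos p u)].
    have h1 : 1 <= \sum_p (near_cut m (t p.1) (pos p u))%:R :> R.
      by rewrite (bigD1 p) //= hp lerDl sumr_ge0 // => q _; exact: ler0n.
    by have := sqr_ge0 (theta u); lra.
  rewrite negb_exists => /forallP far.
  have [p ->] := theta_attained u; have := far p; rewrite /near_cut -leNgt => h.
  have h0 : 0 <= \sum_p (near_cut m (t p.1) (pos p u))%:R :> R.
    by apply: sumr_ge0 => q _; exact: ler0n.
  have : 1 <= ramp m (t p.1) (pos p u) ^+ 2 by rewrite exprn_ege1.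
  lra.
under eq_bigr => u _ do rewrite mulrBr mulr1.
rewrite sumrB -e total_mass; lra.
Qed.

Lemma disjoint_functions_of_shifts : exists g : 'I_k -> 'I_N -> R,
  [/\ forall i, exists u, g i u != 0,
     forall i i' u, i != i' -> g i u * g i' u = 0 &
     forall i, dual_energy w (g i) <= (8 + 896 * 288) * k%:R ^+ 5 * Lam * mass w (g i)].
Proof.
have k1 : 1 <= k%:R :> R by exact: k_ge1.
have dsq u : 0 <= deg w u * sq u by rewrite mulr_ge0 // ltW.
have dst u : 0 <= deg w u * sq u * theta u ^+ 2 by rewrite mulr_ge0 ?sqr_ge0.
have M1 : 1 <= 1 + (4 * k%:R)^-1 :> R by rewrite lerDl invr_ge0; lra.
pose pm (P : {set 'I_N}) := \sum_(u | piece u == P) deg w u * sq u * theta u ^+ 2.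
have pmM P : 0 <= pm P <= 1 + (4 * k%:R)^-1.
  apply/andP; split; first by apply: sumr_ge0.
  apply: le_trans (piece_mass (A := [pred u | piece u == P]) _).
    apply: ler_sum => u _; rewrite -[leRHS]mulr1; apply: ler_wpM2l => //.
    by have /andP[? ?] := theta_bounds u; rewrite exprn_ile1.
  by move=> u v; rewrite !inE => /eqP uP /eqP vP; apply: piece_dot; rewrite uP vP.
have pm_sum (A : {set {set 'I_N}}) :
    \sum_(P in A) pm P = \sum_u deg w u * sq u * theta u ^+ 2 * (piece u \in A)%:R.
  rewrite /pm (exchange_big_dep xpredT) //=; apply: eq_bigr => u _.
  rewrite (eq_bigl (fun P => (P == piece u) && (piece u \in A))); last first.
    by move=> P; rewrite [piece u == P]eq_sym andbC; case: eqP => // ->.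
  case: (piece u \in A); last by rewrite mulr0 big_pred0 // => P; rewrite andbF.
  by rewrite mulr1 (eq_bigl (pred1 (piece u))) ?big_pred1_eq // => P; rewrite andbT.
have [G [_ Gd Gm]] : exists G : nat -> {set {set 'I_N}}, [/\ forall i, G i \subset [set: {set 'I_N}],
    forall i j, (i <= k.-1)%nat -> (j <= k.-1)%nat -> i != j -> [disjoint G i & G j] &
    forall i, (i <= k.-1)%nat -> 1 / 2 <= \sum_(P in G i) pm P].
  (* Indices 0, ..., k - 1 give k groups, and (k - 1) * (1 + 1/(4k)) + 1/2 <= k - 1/4. *)
  apply: (heavy_groups M1 pmM); rewrite pm_sum.
  under [leRHS]eq_bigr => u _ do rewrite inE mulr1.
  apply: le_trans cut_off_mass.
  have -> : k.-1%:R = k%:R - 1 :> R by rewrite -[k in RHS]prednK // -natr1 addrK.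
  have : (4 * k%:R)^-1 * (4 * k%:R) = 1 :> R by rewrite mulVf // gt_eqF //; lra.
  have : 0 <= (4 * k%:R)^-1 :> R by rewrite invr_ge0; lra.
  by move: ((4 * k%:R)^-1) => e e0 e1; lra.
have ile (i : 'I_k) : (i <= k.-1)%nat by have := ltn_ord i; lia.
pose c (i : 'I_k) u : R := (piece u \in G i)%:R.
have c01 i u : c i u = 0 \/ c i u = 1 by rewrite /c; case: (_ \in _); [right|left].
have cc i i' u : i != i' -> c i u * c i' u = 0.
  move=> ii; have := Gd i i' (ile i) (ile i') ii; rewrite disjoint_subset => /subsetP dis.
  rewrite /c; case: (boolP (piece u \in G i)) => h; last by rewrite mul0r.
  by have := dis _ h; rewrite !inE => /negbTE ->; rewrite mulr0.
(* All eigenfunctions are restricted to group i; a good coordinate j is selected only at the end. *)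
pose psi i j u := theta u * f j u * c i u.
have psi_mass i : 1 / 2 <= \sum_j mass w (psi i j).
  apply: le_trans (Gm i (ile i)) _; rewrite pm_sum /mass exchange_big le_eqVlt.
  apply/orP; left; apply/eqP; apply: eq_bigr => u _; rewrite -mulr_sumr -/(c i u).
  rewrite (eq_bigr (fun j => (theta u ^+ 2 * c i u) * f j u ^+ 2)); last first.
    by move=> j _; rewrite /psi; case: (c01 i u) => ->; ring.
  by rewrite -mulr_sumr -/(sq u); ring.
pose EF := \sum_u \sum_v w u v * \sum_j (f j u + f j v) ^+ 2.
have EFle : EF <= k%:R * Lam.
  have -> : EF = \sum_j dual_energy w (f j).
    rewrite /dual_energy [RHS]exchange_big; apply: eq_bigr => u _ /=.
    by rewrite exchange_big; apply: eq_bigr => v _ /=; rewrite mulr_sumr.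
  rewrite mulr_natl -[k in Lam *+ k]card_ord -sumr_const; apply: ler_sum => j _; exact: f_energy.
have EF0 : 0 <= EF.
  apply: sumr_ge0 => u _; apply: sumr_ge0 => v _; rewrite mulr_ge0 // sumr_ge0 // => j _.
  exact: sqr_ge0.
have proj : \sum_j proj_energy j <= 4 * EF.
  rewrite exchange_big /EF mulr_sumr; apply: ler_sum => u _ /=.
  rewrite exchange_big mulr_sumr; apply: ler_sum => v _ /=.
  rewrite -mulr_sumr -mulrA [leRHS]mulrCA; apply: ler_wpM2l => //.
  exact: radial_projection_lip.
have gapE : \sum_u \sum_v w u v * (gap u v * sq v) <= 112 * 288 * k%:R ^+ 4 * EF.
  have -> : \sum_u \sum_v w u v * (gap u v * sq v) = \sum_j fold_energy j (t j).
    rewrite (eq_bigr (fun u => \sum_v \sum_j \sum_(b : bool) w u v * sq v *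
        fold_dist m (t j) (pos (j, b) u) (pos (j, ~~ b) v))); last first.
      move=> u _; apply: eq_bigr => v _; rewrite pair_bigA mulrCA mulr_suml.
      by apply: eq_bigr => -[j b] _ /=; rewrite mulrC.
    under eq_bigr => u _ do rewrite exchange_big.
    rewrite exchange_big; apply: eq_bigr => j _ /=.
    rewrite /fold_energy [RHS]exchange_big; apply: eq_bigr => u _ /=.
    by rewrite exchange_big.
  apply: (@le_trans _ _ (\sum_j 28 * 288 * k%:R ^+ 4 * proj_energy j)).
    by apply: ler_sum => j _; case: (ht j).
  rewrite -mulr_sumr; have k4 : 0 <= k%:R ^+ 4 :> R by rewrite exprn_ge0 //; lra.
  have := ler_wpM2l k4 proj; lra.
(* Both factors 4 are the 2 of [cut_off_pointwise] times the 2 of [two_supports]; 448 is 4 * 112. *)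
have psi_energy : \sum_i \sum_j dual_energy w (psi i j) <= (4 + 448 * 288) * k%:R ^+ 5 * Lam.
  have h1 : \sum_i \sum_j dual_energy w (psi i j) <=
      4 * EF + 4 * \sum_u \sum_v w u v * (gap u v * sq v).
    rewrite /dual_energy exchange_big.
    under eq_bigr => j _ do rewrite exchange_big.
    rewrite exchange_big /EF !mulr_sumr -big_split; apply: ler_sum => u _ /=.
    under eq_bigr => j _ do rewrite exchange_big.
    rewrite exchange_big !mulr_sumr -big_split; apply: ler_sum => v _ /=.
    rewrite (mulrCA 4) (mulrCA 4) -mulrDr; under eq_bigr => j _ do rewrite -mulr_sumr.
    rewrite -mulr_sumr; apply: ler_wpM2l => //.
    rewrite mulrA [X in _ <= X + _]mulr_sumr [X in _ <= _ + X]mulr_sumr -big_split.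
    apply: ler_sum => j _ /=.
    have dis z i i' : i != i' -> psi i j z * psi i' j z = 0.
      by move=> /(cc _ _ z) e; rewrite /psi mulrACA e mulr0.
    have [_] := two_supports (fun i i' => @dis u i i') (fun i i' => @dis v i i').
    have g0 : 0 <= gap u v := le_trans (sqr_ge0 _) (theta_gap u v).
    move=> /(_ (2 * (f j u + f j v) ^+ 2 + 2 * gap u v * f j v ^+ 2)) h.
    have -> : 4 * (f j u + f j v) ^+ 2 + 4 * gap u v * f j v ^+ 2 =
       2 * (2 * (f j u + f j v) ^+ 2 + 2 * gap u v * f j v ^+ 2) by ring.
    apply: h; first by have := mulr_ge0 g0 (sqr_ge0 (f j v)); have := sqr_ge0 (f j u + f j v); lra.
    move=> i; rewrite /psi; apply: cut_off_pointwise => //.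
    - exact: theta_bounds.
    - exact: theta_gap.
    - by move=> cuv; apply: piece_gap; apply: contraNneq cuv; rewrite /c => ->.
  apply: le_trans h1 _.
  have k4 : 1 <= k%:R ^+ 4 :> R by rewrite exprn_ege1.
  have h2 : EF * 1 <= EF * k%:R ^+ 4 by apply: ler_wpM2l.
  have h3 : k%:R ^+ 4 * EF <= k%:R ^+ 4 * (k%:R * Lam) by apply: ler_wpM2l => //; lra.
  have -> : (4 + 448 * 288) * k%:R ^+ 5 * Lam = (4 + 448 * 288) * (k%:R ^+ 4 * (k%:R * Lam)) by ring.
  lra.
set tot := (4 + 448 * 288) * k%:R ^+ 5 * Lam in psi_energy.
have eT : (8 + 896 * 288) * k%:R ^+ 5 * Lam = 2 * tot by rewrite /tot; ring.
(* Averaging over j. Were no j good, the differences energy - 2 * tot * mass would be nonnegative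
   with sum at most 0, hence all 0. A coordinate of positive mass would then be good after all, so
   the total mass would be 0 and not at least 1/2. *)
have each i : exists j, 0 < mass w (psi i j) /\
    dual_energy w (psi i j) <= 2 * tot * mass w (psi i j).
  have [/existsP[j /andP[j1 j2]]|] := boolP [exists j, (0 < mass w (psi i j)) &&
     (dual_energy w (psi i j) <= 2 * tot * mass w (psi i j))]; first by exists j.
  rewrite negb_exists => /forallP bad.
  have Ei : \sum_j dual_energy w (psi i j) <= tot.
    apply: le_trans psi_energy; rewrite [leRHS](bigD1 i) //= lerDl.
    by apply: sumr_ge0 => i' _; apply: sumr_ge0 => j _; exact: dual_energy_ge0.
  have tot0 : 0 <= tot.
    by apply: le_trans Ei; apply: sumr_ge0 => j _; exact: dual_energy_ge0.
  have term j : 0 <= dual_energy w (psi i j) - 2 * tot * mass w (psi i j).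
    have := bad j; rewrite negb_and -leNgt -ltNge => /orP[h|/ltW]; last by rewrite subr_ge0.
    have -> : mass w (psi i j) = 0 by apply/le_anti; rewrite h mass_ge0.
    by rewrite mulr0 subr0 dual_energy_ge0.
  have sum0 : \sum_j (dual_energy w (psi i j) - 2 * tot * mass w (psi i j)) = 0.
    apply/le_anti; rewrite sumr_ge0 ?andbT // sumrB -mulr_sumr.
    have := ler_wpM2l tot0 (psi_mass i); lra.
  have mz : \sum_j mass w (psi i j) = 0.
    apply: big1 => j _; apply/eqP; rewrite -[_ == _]negbK; apply/negP => mj.
    have mp : 0 < mass w (psi i j) by rewrite lt_def mj mass_ge0.
    move/eqP: sum0; rewrite psumr_eq0 // => /allP /(_ j); rewrite mem_index_enum => /(_ isT) /=.
    rewrite subr_eq0 => /eqP e; have := bad j; rewrite mp /= e lexx //.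
  by have := psi_mass i; rewrite mz; lra.
have [jj hjj] := fin_all_exists each.
exists (fun i => psi i (jj i)); split.
- move=> i; have [h _] := hjj i.
  have [/existsP[u hu]|] := boolP [exists u, psi i (jj i) u != 0]; first by exists u.
  rewrite negb_exists => /forallP z; move: h; rewrite /mass big1 ?ltxx // => u _.
  by have := z u; rewrite negbK => /eqP ->; rewrite expr0n mulr0.
- by move=> i i' u /(cc _ _ u) e; rewrite /psi mulrACA e mulr0.
- by move=> i; rewrite eT; case: (hjj i).
Qed.

End Shifted.

Theorem disjoint_functions : exists g : 'I_k -> 'I_N -> R,
  [/\ forall i, exists u, g i u != 0,
     forall i i' u, i != i' -> g i u * g i' u = 0 &
     forall i, dual_energy w (g i) <= (8 + 896 * 288) * k%:R ^+ 5 * Lam * mass w (g i)].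
Proof. by have [t ht] := exists_shifts; exact: (disjoint_functions_of_shifts ht). Qed.

End DisjointFunctions.

(** * The improved dual Cheeger inequality *)

(** The condition [b <= 1] handles the default value of the minimum in [min_phibar]. *)
Lemma hbar_ge (N k : nat) (w : 'I_N -> 'I_N -> R) (V1 V2 : 'I_k -> {set 'I_N}) (b : R) :
  b <= 1 -> (forall i, [disjoint V1 i & V2 i] /\ V1 i :|: V2 i != set0) ->
  (forall i j u, i != j -> u \in V1 i :|: V2 i -> u \notin V1 j :|: V2 j) ->
  (forall i, b <= phibar w (V1 i) (V2 i)) -> b <= hbar w k.
Proof.
move=> b1 ne dis hb; pose V := [ffun i => (V1 i, V2 i)].
apply: (@le_trans _ _ (min_phibar w V)).
  apply/bigmin_geP; split=> [|i _]; first exact: b1.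
  by rewrite !ffunE; exact: hb.
apply: (@le_bigmax_cond _ _ _ _ V) => /=.
have sub (A B C D : {set 'I_N}) : A \subset C -> B \subset D ->
    (forall u, u \in C -> u \notin D) -> [disjoint A & B].
  move=> /subsetP AC /subsetP BD CD; rewrite disjoint_subset; apply/subsetP => u /AC /CD.
  by rewrite inE; apply: contra => /BD.
apply/andP; split; first by apply/forallP => i; rewrite !ffunE /=; apply/andP; exact: ne.
apply/forallP => i; apply/forallP => j; apply/implyP => ij; rewrite !ffunE /=.
by apply/and4P; split; apply: (@sub _ _ (V1 i :|: V2 i) (V1 j :|: V2 j));
   rewrite ?subsetUl ?subsetUr // => u; exact: dis.
Qed.

Theorem theorem6p4 :
  exists C : R, 0 < C /\
  forall (N : nat) (w : 'I_N -> 'I_N -> R) (s : seq R) (k l : nat),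
    weighted_graph w ->
    (forall u, 0 < deg w u) ->
    is_spectrum w s ->
    (1 <= k)%nat -> (k <= l)%nat -> (l <= N)%nat ->
    1 - hbar w k <=
      C * l%:R * k%:R ^+ 6 * ((2 - s`_(N - k)) / Num.sqrt (2 - s`_(N - l))).
Proof.
(* Here 330 is the 165 of the sweep times the 2 in the energy of the eigenfunctions; the other
   factor is that of [disjoint_functions]. *)
exists (330 * (8 + 896 * 288)); split; first by lra.
move=> N w s k l wG d_gt0 spec k1 kl lN.
have k_lt : (N - k < N)%nat by lia.
have l_lt : (N - l < N)%nat by lia.
have lN' : (0 < l <= N)%nat by lia.
have [f [ortho fE]] := top_eigenfunctions wG d_gt0 spec (leq_trans kl lN).
have [g [g0 gd gE]] := disjoint_functions wG d_gt0 k1 ortho fE.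
set gk := 2 - s`_(N - k); set gl := 2 - s`_(N - l).
have gk0 : 0 <= gk := gap_ge0 wG d_gt0 spec k_lt.
(* As k <= l, the eigenvalue at N - k is at least the one at N - l, so it cannot be below 2
   either. *)
have deg0 i : s`_(N - l) = 2 -> dual_energy w (g i) = 0.
  move=> sl; have gk_0 : gk = 0.
    apply/le_anti; rewrite gk0 andbT /gk subr_le0 -sl.
    by apply: (spectrum_le spec); lia.
  apply/le_anti; rewrite dual_energy_ge0 // andbT; apply: le_trans (gE i) _.
  by rewrite -/gk gk_0 !(mulr0, mul0r).
have sweep i := improved_sweep wG d_gt0 spec lN' (g0 i) (deg0 i).
have [V1 sweep1] := fin_all_exists sweep.
have [V2 hV] := fin_all_exists sweep1.
set X := gk / _; set B := _ * X.
have kR : 1 <= k%:R :> R by rewrite ler1n.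
have X0 : 0 <= X by rewrite /X divr_ge0 ?sqrtr_ge0.
have c0 : 0 <= 330 * (8 + 896 * 288) :> R by lra.
have B0 : 0 <= B.
  by rewrite /B; apply: mulr_ge0 => //; apply: mulr_ge0; rewrite ?exprn_ge0 ?ler0n // mulr_ge0 ?ler0n.
suff : 1 - B <= hbar w k by lra.
apply: (@hbar_ge _ _ _ V1 V2); first by lra.
- by move=> i; have [] := hV i.
- move=> i j u ij ui; apply/negP => uj; have [_ _ /(_ u ui) gi _] := hV i.
  have [_ _ /(_ u uj) gj _] := hV j.
  by have /eqP := gd i j u ij; rewrite mulf_eq0 (negbTE gi) (negbTE gj).
move=> i; have [_ _ _ h] := hV i; set phi := 1 - _ in h.
suff : phi <= B by rewrite /phi; lra.
have m0 : 0 < mass w (g i).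
  rewrite lt_def mass_ge0 // andbT; have [u gu] := g0 i; apply: contraNneq gu => mz.
  by rewrite (mass_eq0 d_gt0 mz).
rewrite -(ler_pM2r m0); apply: le_trans h _.
rewrite -/gl; set r := Num.sqrt gl.
have r0 : 0 <= r^-1 by rewrite invr_ge0 sqrtr_ge0.
have l0 : 0 <= l%:R :> R by rewrite ler0n.
have h1 : dual_energy w (g i) / r <=
    (8 + 896 * 288) * k%:R ^+ 5 * (2 * gk) * mass w (g i) / r by apply: ler_wpM2r (gE i).
(* The argument yields the fifth power of k; it is relaxed here to the sixth. *)
have k56 : k%:R ^+ 5 <= k%:R ^+ 6 :> R by apply: ler_weXn2l.
have h2 := ler_wpM2l (_ : 0 <= 165 * l%:R) h1.
apply: le_trans (h2 _) _; first by rewrite mulr_ge0.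
have Y0 : 0 <= l%:R * gk * r^-1 * mass w (g i) by rewrite !mulr_ge0 // ltW.
have := ler_wpM2l Y0 k56; rewrite /B /X -/gl -/r; move: (r^-1) => ri; lra.
Qed.
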